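(* Let $\xi$ be an offspring distribution with $p_i=\mathbf{P}\{\xi=i\}$, $\mathbf{E}\{\xi\}=1$ and variance $\sigma^2=\mathbf{V}\{\xi\}$ satisfying $0<\sigma^2<\infty$. Let $T_n$ be a $\xi$-Galton-Watson tree conditioned to have exactly $n$ nodes, let $\mathrm{R}(T_n)$ be its rigid Horton-Strahler number, and define $$d=\min\{i>1: p_i>0\}.$$ If $d>2$, then $$\frac{\mathrm{R}(T_n)}{\log_2\log_2 n}\to\frac{1}{\log_2(d/2)}$$ in probability as $n\to\infty$. If $d=2$, then, letting $\gamma=1+\sqrt{\sigma^2/(2p_2)}$, $$\frac{\mathrm{R}(T_n)}{\log_2 n}\to\frac{1}{2\log_2\gamma}$$ in probability as $n\to\infty$.
   Context: An offspring distribution is the law of a random variable $\xi$ with values in $\{0,1,2,\dots\}$. The (unconditional) $\xi$-Galton-Watson tree $T$ is the random rooted ordered tree in which each node independently has $i$ children with probability $p_i$; when $\mathbf{E}\{\xi\}=1$ and $p_1\neq 1$ it is almost surely finite. $|T|$ is its number of nodes. $T_n$ denotes a random tree with the law of $T$ given $|T|=n$; here $n$ ranges only over integers with $\mathbf{P}\{|T|=n\}>0$. Rigid Horton-Strahler number $\mathrm{R}(T)$ of a finite rooted tree $T$: if $T$ is a single node, $\mathrm{R}(T)=0$. Otherwise, if the root has $k\ge 1$ children whose subtrees have rigid Horton-Strahler numbers $\mathrm{R}_1\ge \mathrm{R}_2\ge\cdots\ge \mathrm{R}_k\ge 0$ (sorted), then $\mathrm{R}(T)=\mathrm{R}_1$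 if $k=1$, and $\mathrm{R}(T)=\mathrm{R}_1+\mathbf{1}_{[\mathrm{R}_1=\cdots=\mathrm{R}_k]}$ if $k>1$. *)

(* Defs.v *)
From HB Require Import structures.
From mathcomp Require Import all_boot all_order all_algebra.
From mathcomp Require Import all_classical all_reals all_analysis.

Set Implicit Arguments.
Unset Strict Implicit.
Unset Printing Implicit Defensive.

Import Order.TTheory GRing.Theory Num.Theory.
Import numFieldNormedType.Exports.

Local Open Scope classical_set_scope.
Local Open Scope ring_scope.

(* Finite rooted ordered trees: a node carries the list of its subtrees. *)
Inductive tree : Type := Node of seq tree.

Fixpoint tree_size (t : tree) : nat :=
  let: Node ts := t in (sumn (map tree_size ts)).+1.

Fixpoint rigid_HS (t : tree) : nat :=
  let: Node ts := t in
  let rs := map rigid_HS ts in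
  match rs with
  | [::] => 0%N
  | [:: r] => r
  | _ => let r1 := foldr maxn 0%N rs in (r1 + all (pred1 r1) rs)%N
  end.

(* Nodes are addressed by words over nat (Ulam-Harris), the i-th child of u
   being rcons u i; x u is the number of children requested at address u.
   [gw_tree x t] says that the tree grown from x is the finite tree t. There is
   at most one such t, and none exactly when the tree grown from x is infinite. *)
Inductive gw_tree (x : seq nat -> nat) : tree -> Prop :=
  GwNode ts of size ts = x [::]
  & (forall i, (i < size ts)%N ->
       gw_tree (fun u => x (i :: u)) (nth (Node [::]) ts i)) :
  gw_tree x (Node ts).

Section probability.
Context d (Omega : measurableType d) (R : realType) (P : probability Omega R).

Definition mutually_independent (I : eqType) (X : I -> {RV P >-> nat}) : Prop :=
  forall (us : seq I) (A : I -> set nat), uniq us ->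
    P (\big[setI/setT]_(u <- us) X u @^-1` A u) =
    (\prod_(u <- us) P (X u @^-1` A u))%E.

Definition iid_family (I : eqType) (X : I -> {RV P >-> nat})
    (mu : probability nat R) : Prop :=
  (forall u A, distribution P (X u) A = mu A) /\ mutually_independent X.

Definition gw_event (X : seq nat -> {RV P >-> nat}) (Q : set tree) : set Omega :=
  [set w | exists2 t, gw_tree (fun u => X u w) t & Q t].

Definition size_event (X : seq nat -> {RV P >-> nat}) (n : nat) : set Omega :=
  gw_event X [set t | tree_size t = n].

Definition cond_prob (A B : set Omega) : R := fine (P (A `&` B)) / fine (P B).

(* f n (T_n) -> l in probability, where T_n has the law of T given |T| = n and
   n is restricted to the integers with P(|T| = n) > 0. *)
Definition cvg_in_prob_given_size (X : seq nat -> {RV P >-> nat})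
    (f : nat -> tree -> R) (l : R) : Prop :=
  forall eps : R, 0 < eps ->
    cond_prob (gw_event X [set t | eps < `|f n t - l|]) (size_event X n)
      @[n --> within [set n | (0 < P (size_event X n))%E] \oo] --> (0 : R).

End probability.

Section offspring.
Context (R : realType) (mu : probability nat R).

Definition offspring_pmf (i : nat) : R := fine (mu [set i]).

(* The offspring variable, seen as the real-valued identity on (nat, mu). *)
Definition offspring (i : nat) : R := i%:R.

Definition is_min_branching (d : nat) : Prop :=
  [/\ (1 < d)%N, 0 < offspring_pmf d &
      forall i, (1 < i)%N -> 0 < offspring_pmf i -> (d <= i)%N].

End offspring.

Definition log2 (R : realType) (x : R) : R := ln x / ln 2.

(* Main.v *)
Require Import Defs.
From HB Require Import structures.
From mathcomp Require Import all_boot all_order all_algebra.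
From mathcomp Require Import all_classical all_reals all_analysis.
From mathcomp Require Import zify ring lra.

Set Implicit Arguments.
Unset Strict Implicit.
Unset Printing Implicit Defensive.

Import Order.TTheory GRing.Theory Num.Theory.
Import numFieldNormedType.Exports.

Local Open Scope classical_set_scope.
Local Open Scope ring_scope.

(** Below, the number of a tree is its rigid Horton-Strahler number, [p] is the
   offspring law, [G] its generating function, [s2] its variance and [d] the
   least branching number.

   Let [s_r] be the probability that the unconditioned tree has number
   above [r].  A tree has number at most [r] if and only if all its subtrees at
   the root do and it is not the case that there are at least two of them, all
   with number exactly [r].  Hence
     1 - s_r = G (1 - s_r) - sum over i > 1 of p_i (s_{r-1} - s_r) ^ i,
   and since G (1 - s) = 1 - s + s2 / 2 * s ^ 2 + o (s ^ 2), the linear terms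
   cancel and leave
     s2 / 2 * s_r ^ 2 ~ p_d (s_{r-1} - s_r) ^ d.
   For [d = 2] the ratio s_{r-1} / s_r tends to
   gamma = 1 + sqrt (s2 / (2 p_2)); for [d > 2], s_r is of the order of
   s_{r-1} ^ (d / 2), so that ln (1 / s_r) grows like (d / 2) ^ r.  In both
   cases the asserted level is the one where s_r crosses n ^ (- 1 / 2).

   Conditioning on size [n] costs only a power of [n], so it suffices that, a
   little below and a little above this level, the joint probabilities with
   size [n] decay faster than any power of [n].

   - Below ([sized_HS_le]).  If s_r is much larger than n ^ (- 1 / 2), choose a
     height [k] with 1 / s_r << k << sqrt n.  A path of length [k] all of whose
     side trees have number at most [r] has mass at most
     G' (1 - s_r) ^ k <= (1 - p_d s_r) ^ k, while a tree of height at most [k]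
     has size [n] with probability at most exp (- c n / k ^ 2): tilt every node
     by a factor 1 + c / k ^ 2.

   - Above ([sized_HS_gt], for [d = 2]).  Weigh every node by 1 - 1 / (2 n),
     which costs a bounded factor on trees of size [n] but makes the process
     subcritical, with a drift of order n ^ (- 1 / 2).  The mass x of the trees
     with number above [r] is then at most of order sqrt n * x ^ 2 one level
     higher, so once it is below n ^ (- 1 / 2 - theta) a bounded number of
     further levels makes it smaller than any given power.  For [d > 2], the
     tail s_r itself is already superpolynomially small.

   - The cost of conditioning ([sized_ge]).  By the cycle lemma the probability
     of size [n] is at least 1 / n times the probability that [n] independent
     offspring numbers have sum [n - 1].  By Chebyshev's inequality and the
     pigeonhole principle some triple (number of letters 0, number of letters
     [d], sum of the other letters) close to its mean has at least polynomially
     small probability; exchanging O (sqrt n) letters 0 and [d] corrects the sum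
     up to a residue modulo [d] at the cost of a constant factor, and a bounded
     number of extra letters corrects the residue.

   All masses are finite sums over the trees of height at most [h] and degree
   at most [D], and are estimated by induction on [h], uniformly in [D]. *)

(** * Finite trees *)

Lemma tree_nth_ind (Q : tree -> Prop) :
  (forall ts, (forall i, (i < size ts)%N -> Q (nth (Node [::]) ts i)) ->
     Q (Node ts)) ->
  forall t, Q t.
Proof.
move=> step; fix IH 1; case=> ts; apply: step.
elim: ts => [i H|t ts IHts i]; first discriminate H.
case: i => [_|i lti]; [exact: IH | exact: IHts].
Qed.

Fixpoint tree_code (t : tree) : GenTree.tree unit :=
  let: Node ts := t in GenTree.Node 0 (map tree_code ts).

Fixpoint tree_decode (c : GenTree.tree unit) : tree :=
  if c is GenTree.Node _ cs then Node (map tree_decode cs) else Node [::].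

Lemma tree_codeK : cancel tree_code tree_decode.
Proof.
elim/tree_nth_ind => ts IH /=; congr Node; rewrite -map_comp.
apply: (@eq_from_nth _ (Node [::])); rewrite size_map // => i lti.
by rewrite (nth_map (Node [::])) //= IH.
Qed.

HB.instance Definition _ := Countable.copy tree (can_type tree_codeK).

Lemma tree_ind_mem (Q : tree -> Prop) :
  (forall ts, (forall t, t \in ts -> Q t) -> Q (Node ts)) -> forall t, Q t.
Proof.
move=> step; elim/tree_nth_ind => ts IH; apply: step => t tts.
by rewrite -(nth_index (Node [::]) tts); apply: IH; rewrite index_mem.
Qed.

(** Leaves have height 1: a bound by 0 then describes the empty family of
   trees, from which the inductions on the height start. *)
Fixpoint tree_height (t : tree) : nat :=
  let: Node ts := t in (foldr maxn 0%N (map tree_height ts)).+1.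

Lemma foldr_maxn_leP (s : seq nat) k :
  (foldr maxn 0%N s <= k)%N = all (fun x => x <= k)%N s.
Proof. by elim: s => //= x s IH; rewrite geq_max IH. Qed.

Lemma tree_height_le ts k :
  (tree_height (Node ts) <= k.+1)%N = all (fun t => tree_height t <= k)%N ts.
Proof. by rewrite /= ltnS foldr_maxn_leP all_map. Qed.

Lemma tree_size_gt0 t : (0 < tree_size t)%N. Proof. by case: t. Qed.

Lemma mem_sumn (s : seq nat) x : x \in s -> (x <= sumn s)%N.
Proof.
elim: s => //= y s IH; rewrite in_cons => /predU1P[->|/IH]; lia.
Qed.

Lemma tree_height_size t : (tree_height t <= tree_size t)%N.
Proof.
elim/tree_ind_mem: t => ts IH /=; rewrite ltnS foldr_maxn_leP all_map.
apply/allP => t tts /=; apply: leq_trans (IH _ tts) _.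
by apply: mem_sumn; apply: map_f.
Qed.

Fixpoint tree_deg_le (D : nat) (t : tree) : bool :=
  let: Node ts := t in (size ts <= D)%N && all id (map (tree_deg_le D) ts).

Lemma size_le_sumn ts : (size ts <= sumn (map tree_size ts))%N.
Proof. by elim: ts => //= t ts IH; move: (tree_size_gt0 t) => s0; lia. Qed.

Lemma tree_deg_le_size D t : (tree_size t <= D)%N -> tree_deg_le D t.
Proof.
elim/tree_ind_mem: t => ts IH /= szD; have := size_le_sumn ts.
move=> szs; rewrite (leq_trans szs) /=; last exact: ltnW.
rewrite all_map; apply/allP => t tts /=; apply: IH => //.
have /mem_sumn := map_f tree_size tts; move=> le1.
exact: leq_trans le1 (ltnW szD).
Qed.

(** All of the recursion for the numbers is used in this form: the condition on
   the children is a difference of two conditions of type [all], and each of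
   these gives a power of a mass. *)
Lemma rigid_HS_le ts r : (rigid_HS (Node ts) <= r)%N =
  all (fun t => rigid_HS t <= r)%N ts &&
  ~~ ((1 < size ts)%N && all (fun t => rigid_HS t == r) ts).
Proof.
have E : (ts = [::] \/ exists t, ts = [:: t]) \/
          exists t1 t2 ts', ts = [:: t1, t2 & ts'].
  case: ts => [|t1 [|t2 ts']]; first by left; left.
    by left; right; exists t1.
  by right; exists t1, t2, ts'.
case: E => [[->//|[t ->]]|[t1 [t2 [ts' ets]]]]; first by rewrite /= !andbT.
have -> : rigid_HS (Node ts) = (foldr maxn 0 (map rigid_HS ts) +
    all (pred1 (foldr maxn 0 (map rigid_HS ts))) (map rigid_HS ts))%N by rewrite ets.
have -> : (1 < size ts)%N by rewrite ets.
have ne : map rigid_HS ts != [::] by rewrite ets.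
rewrite -(all_map rigid_HS (fun x => x <= r)%N) -(all_map rigid_HS (pred1 r)).
move: (map rigid_HS ts) ne => s ne {ts ets t1 t2 ts'}.
rewrite -foldr_maxn_leP /=; set M := foldr _ _ _.
case: (ltngtP M r) => [ltMr|ltrM|<-].
- rewrite (leq_trans (leq_add (leqnn M) (leq_b1 _))) ?addn1 //=.
  symmetry; case: s ne @M ltMr => // x s _ /= ltMr.
  apply/negP => /andP[/eqP exr _].
  by move: ltMr; rewrite exr ltnNge leq_maxl.
- by apply/negbTE; rewrite -ltnNge (leq_trans ltrM) // leq_addr.
- by case: all; rewrite ?addn1 ?addn0 ?ltnn ?leqnn.
Qed.

Lemma rigid_HS_eq_le t r : (rigid_HS t == r.+1) =
  (rigid_HS t <= r.+1)%N && ~~ (rigid_HS t <= r)%N.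
Proof. lia. Qed.

(** * Sums over words and over trees of bounded height and degree *)

Fixpoint words (T : Type) (L : seq T) (n : nat) : seq (seq T) :=
  if n is m.+1 then [seq x :: w | x <- L, w <- words L m] else [:: [::]].

Lemma mem_words (T : eqType) (L : seq T) n w :
  (w \in words L n) = (size w == n) && all (mem L) w.
Proof.
elim: n w => [|n IH] w /=; first by rewrite inE; case: w.
apply/allpairsP/idP => [[[x v] /= [xL + ->]]|]; first by rewrite IH /= eqSS xL.
case: w => // x v; rewrite /= eqSS => /andP[sz /andP[xL aL]].
by exists (x, v); split => //=; rewrite IH sz.
Qed.

Lemma uniq_words (T : eqType) (L : seq T) n : uniq L -> uniq (words L n).
Proof.
move=> uL; elim: n => //= n IH; apply: allpairs_uniq => //.
by move=> [x v] [y w] _ _ /= [-> ->].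
Qed.

Lemma big_words_cons (R : nmodType) (T : Type) (L : seq T) n
    (F : seq T -> R) :
  \sum_(w <- words L n.+1) F w = \sum_(x <- L) \sum_(w <- words L n) F (x :: w).
Proof. by rewrite /= big_allpairs_dep. Qed.

Lemma big_words_all (R : comPzRingType) (T : Type) (L : seq T) n (S : pred T)
    (F : T -> R) :
  \sum_(w <- words L n | all S w) \prod_(x <- w) F x =
  (\sum_(x <- L | S x) F x) ^+ n.
Proof.
elim: n => [|n IH]; first by rewrite big_mkcond big_seq1 /= big_nil.
rewrite big_mkcond big_words_cons exprS -IH mulr_suml [RHS]big_mkcond.
apply: eq_bigr => x _; rewrite -big_mkcond /=.
case: (S x) => /=; last by rewrite big_pred0.
by rewrite mulr_sumr; apply: eq_bigr => w _; rewrite big_cons.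
Qed.

(** The degree bound is there only to make the enumeration finite. *)
Fixpoint trees (D h : nat) : seq tree :=
  if h is k.+1
  then map Node (flatten [seq words (trees D k) i | i <- iota 0 D.+1])
  else [::].

Lemma treesS D h : trees D h.+1 =
  map Node (flatten [seq words (trees D h) i | i <- iota 0 D.+1]).
Proof. by []. Qed.

Lemma mem_trees D h t :
  (t \in trees D h) = (tree_height t <= h)%N && tree_deg_le D t.
Proof.
elim: h t => [|h IH] [ts]; first by [].
rewrite tree_height_le treesS mem_map; last by move=> ? ? [].
apply/flatten_mapP/idP => [[i + ]|/and3P[hts szts dts]].
  rewrite mem_iota mem_words => /= iD /andP[/eqP szts /allP mts].
  rewrite szts -ltnS iD all_map; apply/andP; split; apply/allP => t /mts /=;
  by rewrite IH => /andP[].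
exists (size ts); first by rewrite mem_iota.
rewrite mem_words eqxx; apply/allP => t tts /=; rewrite IH.
by rewrite (allP hts) //; move: dts; rewrite all_map => /allP/(_ _ tts).
Qed.

Lemma uniq_trees D h : uniq (trees D h).
Proof.
elim: h => // h IH; rewrite treesS map_inj_uniq; last by move=> ? ? [].
elim: (iota 0 D.+1) (iota_uniq 0 D.+1) => //= i s IHs /andP[nis /IHs us].
rewrite cat_uniq uniq_words // us andbT; apply/hasPn => w /flatten_mapP[j js].
rewrite !mem_words => /andP[/eqP szw _]; apply/negP => /andP[/eqP szi _].
by move: nis; rewrite -szi szw js.
Qed.

Lemma trees_of_size n D h t : tree_size t = n -> (n <= D)%N -> (n <= h)%N ->
  t \in trees D h.
Proof.
move=> szt nD nh; rewrite mem_trees tree_deg_le_size ?szt // andbT.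
by rewrite (leq_trans (tree_height_size t)) ?szt.
Qed.

Section Weights.
Variables (R : realType) (p : nat -> R).

(** For [z = 1] this is the probability that the Galton-Watson tree is the given
   tree; a parameter [z] other than 1 tilts the law of the size. *)
Fixpoint weight (z : R) (t : tree) : R :=
  let: Node ts := t in z * p (size ts) * \prod_(x <- map (weight z) ts) x.

Definition mass (z : R) (D h : nat) (S : pred tree) : R :=
  \sum_(t <- trees D h | S t) weight z t.

Lemma weightE z ts :
  weight z (Node ts) = z * p (size ts) * \prod_(t <- ts) weight z t.
Proof. by rewrite /= big_map. Qed.

Lemma weight_size z t : weight z t = z ^+ tree_size t * weight 1 t.
Proof.
elim/tree_ind_mem: t => ts IH; rewrite !weightE mul1r /= exprS.
suff -> : \prod_(t <- ts) weight z t =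
    z ^+ sumn (map tree_size ts) * \prod_(t <- ts) weight 1 t by ring.
elim: ts IH => [|t ts IHts] IH; first by rewrite !big_nil expr0 mul1r.
rewrite !big_cons /= exprD IH ?mem_head // IHts; first by ring.
by move=> s sts; apply: IH; rewrite in_cons sts orbT.
Qed.

Lemma mass0 z D S : mass z D 0 S = 0. Proof. by rewrite /mass big_nil. Qed.

Lemma mass_words z D h (S : pred tree) :
  mass z D h.+1 S = \sum_(i < D.+1) z * p i *
    \sum_(w <- words (trees D h) i | S (Node w)) \prod_(t <- w) weight z t.
Proof.
rewrite /mass treesS big_map big_mkcond big_flatten big_map.
rewrite -(big_mkord xpredT (fun i => z * p i *
  \sum_(w <- words (trees D h) i | S (Node w)) \prod_(t <- w) weight z t)).
rewrite /index_iota subn0; apply: eq_bigr => i _.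
rewrite -big_mkcond mulr_sumr big_seq_cond [RHS]big_seq_cond.
apply: eq_bigr => w; rewrite mem_words => /andP[/andP[/eqP szw _] _].
by rewrite weightE szw.
Qed.

Hypothesis p_ge0 : forall i, 0 <= p i.

Lemma weight_ge0 z t : 0 <= z -> 0 <= weight z t.
Proof.
move=> z0; elim/tree_ind_mem: t => ts IH; rewrite weightE.
apply: mulr_ge0; first exact: mulr_ge0.
by rewrite big_seq; apply: prodr_ge0.
Qed.

Lemma mass_ge0 z D h S : 0 <= z -> 0 <= mass z D h S.
Proof. by move=> z0; apply: sumr_ge0 => t _; apply: weight_ge0. Qed.

Lemma mass_sub z D h (S S' : pred tree) : 0 <= z -> (forall t, S t -> S' t) ->
  mass z D h S <= mass z D h S'.
Proof.
move=> z0 SS'; rewrite /mass big_mkcond [leRHS]big_mkcond.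
apply: ler_sum => t _; case: ifP => [/SS'->//|_].
by case: ifP => // _; apply: weight_ge0.
Qed.

Lemma massD z D h (S S' : pred tree) : (forall t, S t -> S' t) ->
  mass z D h S' = mass z D h S + mass z D h (fun t => S' t && ~~ S t).
Proof.
move=> SS'; rewrite /mass big_mkcond [X in _ = X + _]big_mkcond.
rewrite [X in _ = _ + X]big_mkcond -big_split; apply: eq_bigr => t _ /=.
by case: (boolP (S t)) => [/SS'->|_]; rewrite ?addr0 ?andbT ?add0r.
Qed.

End Weights.

(** * Elementary bounds on powers *)

Section Powers.
Variable R : realFieldType.
Implicit Types s a A X : R.

Lemma expr_taylor1 s i : 0 <= s <= 1 -> 1 - i%:R * s <= (1 - s) ^+ i.
Proof.
move=> s01; elim: i => [|i IH]; first by rewrite expr0; lra.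
rewrite [leRHS]exprS; apply: le_trans (ler_wpM2l _ IH); last by lra.
have h : 0 <= i%:R * s ^+ 2 by rewrite mulr_ge0 ?sqr_ge0.
by rewrite -[i.+1%:R]natr1; lra.
Qed.

Lemma expr_taylor2 s i : 0 <= s <= 1 ->
  (1 - s) ^+ i <= 1 - i%:R * s + i%:R * (i%:R - 1) / 2 * s ^+ 2.
Proof.
move=> s01; elim: i => [|i IH]; first by rewrite expr0; lra.
rewrite exprS; apply: le_trans (ler_wpM2l _ IH) _; first by lra.
have h : 0 <= (i%:R * (i%:R - 1)) * s ^+ 3.
  rewrite mulr_ge0 ?exprn_ge0//; last by lra.
  by case: i {IH} => [|i]; rewrite ?mul0r// mulr_ge0// mulrSr addrK.
by rewrite -[i.+1%:R]natr1; lra.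
Qed.

Lemma expr_taylor3 s i : 0 <= s <= 1 ->
  1 - i%:R * s + i%:R * (i%:R - 1) / 2 * s ^+ 2 - i%:R ^+ 3 * s ^+ 3
    <= (1 - s) ^+ i.
Proof.
move=> s01; elim: i => [|i IH]; first by rewrite expr0; lra.
rewrite [leRHS]exprS; apply: le_trans (ler_wpM2l _ IH); last by lra.
have x0 : 0 <= i%:R :> R by [].
rewrite -[i.+1%:R]natr1; move: (i%:R) x0 => x x0 {IH}.
have x2 : 0 <= x ^+ 2 by exact: sqr_ge0.
have h1 : 0 <= (x ^+ 2 * 5 / 2 + 7 / 2 * x + 1) * s ^+ 3.
  by rewrite mulr_ge0 ?exprn_ge0//; lra.
have h2 : 0 <= x ^+ 3 * s ^+ 4 by rewrite mulr_ge0 ?exprn_ge0//; lra.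
by lra.
Qed.

Lemma expr_lower2 s i : 0 <= s <= 1 -> (1 < i)%N ->
  1 - i%:R * s + s ^+ 2 <= (1 - s) ^+ i.
Proof.
move=> s01; case: i => [|[|i]] // _; elim: i => [|i IH].
  by rewrite le_eqVlt; apply/orP; left; apply/eqP; ring.
rewrite [leRHS]exprS; apply: le_trans (ler_wpM2l _ IH); last by lra.
have h : 0 <= i%:R * s ^+ 2 by rewrite mulr_ge0 ?sqr_ge0.
have s2 := sqr_ge0 s.
have h3 : s ^+ 3 <= s ^+ 2 by rewrite ler_wiXn2l//; lra.
by rewrite -[i.+3%:R]natr1 -[i.+2%:R]natr1 -[i.+1%:R]natr1; lra.
Qed.

(** Convexity of the power: increments of a given length increase. *)
Lemma expr_diff_le a A X i : 0 <= a -> a <= A -> A <= X ->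
  A ^+ i - (A - a) ^+ i <= X ^+ i - (X - a) ^+ i.
Proof.
move=> a0 aA AX; elim: i => [|i IH]; first by rewrite !expr0.
have E (Y : R) : Y ^+ i.+1 - (Y - a) ^+ i.+1 =
    Y * (Y ^+ i - (Y - a) ^+ i) + a * (Y - a) ^+ i by rewrite !exprS; ring.
rewrite !E; apply: lerD.
  apply: ler_pM => //; first by lra.
  by rewrite subr_ge0; apply: lerXn2r; rewrite ?nnegrE; lra.
by apply: ler_wpM2l => //; apply: lerXn2r; rewrite ?nnegrE; lra.
Qed.

Lemma expr_diff_deriv a X i : 0 <= a -> a <= X ->
  X ^+ i - (X - a) ^+ i <= a * (i%:R * X ^+ i.-1).
Proof.
move=> a0 aX; elim: i => [|[|i] IH]; first by rewrite !expr0; lra.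
  by rewrite expr0; lra.
have E : X ^+ i.+2 - (X - a) ^+ i.+2 =
    X * (X ^+ i.+1 - (X - a) ^+ i.+1) + a * (X - a) ^+ i.+1.
  by rewrite [in LHS]exprS [(X - a) ^+ i.+2]exprS; ring.
rewrite E; have h1 : (X - a) ^+ i.+1 <= X ^+ i.+1.
  by apply: lerXn2r; rewrite ?nnegrE; lra.
apply: le_trans (lerD (ler_wpM2l _ IH) (ler_wpM2l a0 h1)) _; first by lra.
by rewrite le_eqVlt; apply/orP; left; apply/eqP; rewrite /= !mulrSr !exprS; ring.
Qed.

End Powers.

(** * Critical offspring laws *)

Record critical_law (R : realType) (p : nat -> R) (s2 : R) : Prop := {
  law_ge0 : forall i, 0 <= p i;
  law_mass : \sum_(i < n) p i @[n --> \oo] --> (1 : R);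
  law_mean : \sum_(i < n) p i * i%:R @[n --> \oo] --> (1 : R);
  law_moment2 :
    \sum_(i < n) p i * (i%:R * (i%:R - 1)) @[n --> \oo] --> (s2 : R) }.

Record min_branching (R : realType) (p : nat -> R) (d : nat) : Prop := {
  branch_gt1 : (1 < d)%N;
  branch_gt0 : 0 < p d;
  branch_min : forall i, (1 < i)%N -> (i < d)%N -> p i = 0 }.

Section CriticalLaw.
Variables (R : realType) (p : nat -> R) (s2 : R).
Hypothesis hp : critical_law p s2.

(** An expectation is bounded through a quadratic majorant, whose own expectation
   is known exactly in the limit of untruncated sums.  The gain [g] on finitely
   many values survives the limit; nonnegativity of [f] makes its truncated
   expectations lie below the limit. *)
Lemma moment_bound (f g : nat -> R) (N : nat) (a b c : R) :
  (forall i, 0 < p i -> 0 <= f i) ->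
  (forall i, 0 < p i -> f i <= a + b * i%:R + c * (i%:R * (i%:R - 1)) - g i) ->
  (forall i, (N <= i)%N -> g i = 0) ->
  forall D, \sum_(i < D) p i * f i <= a + b + c * s2 - \sum_(i < N) p i * g i.
Proof.
move=> f0 fle gN D.
have pcase i : p i = 0 \/ 0 < p i.
  by have := law_ge0 hp i; rewrite le_eqVlt => /predU1P[<-|]; [left|right].
have cv : a * (\sum_(i < n) p i) + b * (\sum_(i < n) p i * i%:R) +
    c * (\sum_(i < n) p i * (i%:R * (i%:R - 1))) - \sum_(i < N) p i * g i
    @[n --> \oo] --> a * 1 + b * 1 + c * s2 - \sum_(i < N) p i * g i.
  apply: cvgB; last exact: cvg_cst.
  apply: cvgD; last by apply: cvgM; [exact: cvg_cst | exact: (law_moment2 hp)].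
  apply: cvgD; apply: cvgM; [exact: cvg_cst| |exact: cvg_cst|].
    exact: (law_mass hp).
  exact: (law_mean hp).
rewrite !mulr1 in cv.
apply: (cvgr_to_ge cv); exists (D + N)%N => // n /= DNn.
rewrite -(big_mkord xpredT (fun i => p i * f i)).
have Dn : (D <= n)%N by exact: leq_trans (leq_addr _ _) DNn.
have Nn : (N <= n)%N by exact: leq_trans (leq_addl _ _) DNn.
apply: (@le_trans _ _ (\sum_(0 <= i < n) p i * f i)).
  rewrite [leRHS](@big_cat_nat _ _ _ D) //= lerDl; apply: sumr_ge0 => i _.
  by case: (pcase i) => [->|p0]; rewrite ?mul0r// mulr_ge0 ?f0// ltW.
have -> : \sum_(i < N) p i * g i = \sum_(0 <= i < n) p i * g i.
  have Z : \sum_(N <= i < n) p i * g i = 0.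
    by rewrite big_nat big1 // => i /andP[Ni _]; rewrite gN ?mulr0.
  by rewrite [RHS](@big_cat_nat _ _ _ N) //= Z addr0 big_mkord.
rewrite !big_mkord !mulr_sumr -!big_split -sumrB.
apply: ler_sum => i _ /=.
case: (pcase i) => [->|p0]; first by rewrite !(mul0r, mulr0) !addr0 subr0.
apply: le_trans (ler_wpM2l (ltW p0) (fle i p0)) _.
by rewrite le_eqVlt; apply/orP; left; apply/eqP; ring.
Qed.

Lemma pgf_le s D : 0 <= s <= 1 ->
  \sum_(i < D) p i * (1 - s) ^+ i <= 1 - s + s2 / 2 * s ^+ 2.
Proof.
move=> s01.
apply: (le_trans (@moment_bound (fun i => (1 - s) ^+ i) (fun=> 0) 0 1 (- s) (s ^+ 2 / 2) _ _ _ D)) => //.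
- by move=> i _; rewrite exprn_ge0//; lra.
- by move=> i _; apply: le_trans (expr_taylor2 _ s01) _; lra.
- by rewrite big_ord0; lra.
Qed.

Lemma pgf_le1 x D : 0 <= x <= 1 -> \sum_(i < D) p i * x ^+ i <= 1.
Proof.
move=> x01.
apply: (le_trans (@moment_bound (fun i => x ^+ i) (fun=> 0) 0 1 0 0 _ _ _ D)) => //.
- by move=> i _; rewrite exprn_ge0//; lra.
- by move=> i _; rewrite !mul0r !addr0 subr0; apply: exprn_ile1; lra.
- by rewrite big_ord0; lra.
Qed.

Lemma law_le1 i : p i <= 1.
Proof.
have H : \sum_(j < i.+1) p j * 1 ^+ j <= 1.
  by apply: pgf_le1; rewrite ler01 lexx.
rewrite big_ord_recr /= expr1n mulr1 in H; apply: le_trans H.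
by rewrite lerDr sumr_ge0// => j _; rewrite expr1n mulr1 (law_ge0 hp).
Qed.

Lemma variance_ge (N : nat) :
  \sum_(i < N) p i * (i%:R * (i%:R - 1)) <= s2.
Proof.
apply: (le_trans (@moment_bound (fun i => i%:R * (i%:R - 1)) (fun=> 0) 0 0 0 1 _ _ _ N)) => //.
- by move=> [|i] _; rewrite ?mul0r// mulr_ge0// mulrSr addrK.
- by move=> i _; rewrite !mul0r mul1r !add0r subr0.
- by rewrite big_ord0; lra.
Qed.

Variable d : nat.
Hypothesis hd : min_branching p d.

Lemma sum_at_d (c : R) : \sum_(i < d.+1) p i * (c *+ (i == d :> nat)) = c * p d.
Proof.
rewrite big_ord_recr /= eqxx mulr1n big1 ?add0r; first by rewrite mulrC.
by move=> i _; rewrite (ltn_eqF (ltn_ord i)) mulr0n mulr0.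
Qed.

Lemma not_d (c : R) i : (d < i)%N -> c *+ (i == d) = 0.
Proof. by move=> di; rewrite gtn_eqF. Qed.

(** The decay is linear in [s], as for the exact derivative; its rate comes from
   the term [i = d] alone, instead of [s2]. *)
Lemma pgf_deriv_le s D : 0 <= s <= 1 ->
  \sum_(i < D) p i * (i%:R * (1 - s) ^+ i.-1) <= 1 - s * p d.
Proof.
move=> s01; have d1 := branch_gt1 hd.
apply: (le_trans (@moment_bound (fun i => i%:R * (1 - s) ^+ i.-1)
  (fun i => s *+ (i == d)) d.+1 0 1 0 _ _ _ D)) => //.
- by move=> i _; rewrite mulr_ge0 ?exprn_ge0//; lra.
- move=> i _; rewrite mul0r addr0 add0r mul1r; case: eqP => [->|_].
    have : (1 - s) ^+ d.-1 <= 1 - s by rewrite -[leRHS]expr1 ler_wiXn2l//; lra || lia.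
    have : 1 <= d%:R :> R by rewrite ler1n; lia.
    by rewrite mulr1n; nra.
  by rewrite subr0 ler_piMr//; apply: exprn_ile1; lra.
- exact: not_d.
- by rewrite sum_at_d; lra.
Qed.

(** The two sides compare a mass [1 - s'] with its image by the recursion for
   numbers at most [r + 1], when the mass of numbers at most [r] is [1 - s]. *)
Lemma no_rise_bound s s' D : 0 <= s' -> s' <= s -> s <= 1 ->
  \sum_(i < D) p i * ((1 - s') ^+ i - (s - s') ^+ i *+ (1 < i)%N) <=
  1 - s' + s2 / 2 * s' ^+ 2 - (s - s') ^+ d * p d.
Proof.
move=> s0 ss s1; have d1 := branch_gt1 hd.
have s01 : 0 <= s' <= 1 by lra.
apply: (le_trans (@moment_bound (fun i => (1 - s') ^+ i - (s - s') ^+ i *+ (1 < i)%N)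
  (fun i => (s - s') ^+ d *+ (i == d)) d.+1 1 (- s') (s' ^+ 2 / 2) _ _ _ D)) => //.
- move=> i _; case: ltnP => _; last by rewrite subr0 exprn_ge0; lra.
  by rewrite subr_ge0; apply: lerXn2r; rewrite ?nnegrE; lra.
- move=> i _; apply: lerB; first by apply: le_trans (expr_taylor2 _ s01) _; lra.
  case: eqP => [->|_]; first by rewrite d1.
  by rewrite mulrn_wge0// exprn_ge0//; lra.
- exact: not_d.
- by rewrite sum_at_d; lra.
Qed.

(** The quadratic gain comes from the term [i = d] alone, so that it holds on the
   whole range of [s] and [s'], in general with a constant below [s2 / 2]. *)
Lemma rise_bound s s' D : 0 <= s' -> s' <= s -> s <= 1 ->
  \sum_(i < D) p i * (1 - (1 - s') ^+ i + (s - s') ^+ i *+ (1 < i)%N) <=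
  s' - s' ^+ 2 * p d + (s - s') ^+ d.
Proof.
move=> s0 ss s1; have d1 := branch_gt1 hd.
have s01 : 0 <= s' <= 1 by lra.
have t01 : 0 <= s - s' <= 1 by lra.
apply: (le_trans (@moment_bound (fun i => 1 - (1 - s') ^+ i + (s - s') ^+ i *+ (1 < i)%N)
  (fun i => s' ^+ 2 *+ (i == d)) d.+1 ((s - s') ^+ d) s' 0 _ _ _ D)) => //.
- move=> i _; apply: addr_ge0; first by rewrite subr_ge0; apply: exprn_ile1; lra.
  by rewrite mulrn_wge0// exprn_ge0//; lra.
- move=> i pgt; rewrite mul0r addr0.
  have -> : (s - s') ^+ d + s' * i%:R - s' ^+ 2 *+ (i == d) =
    (i%:R * s' - s' ^+ 2 *+ (i == d)) + (s - s') ^+ d by ring.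
  apply: lerD.
    case: eqP => [->|_]; last first.
      by have := expr_taylor1 i s01; rewrite mulr0n; lra.
    by have := expr_lower2 s01 d1; rewrite mulr1n; lra.
  case: (ltnP 1 i) => i1; last by rewrite exprn_ge0; lra.
  rewrite mulr1n ler_wiXn2l//; try by lra.
  by rewrite leqNgt; apply/negP => id; move: pgt; rewrite (branch_min hd) ?ltxx.
- exact: not_d.
- by rewrite sum_at_d; lra.
Qed.

(** Here the constant [s2 / 2] is needed up to [e]: the Taylor expansion of order
   three is used on the first [N] terms, which carry all of the variance but
   [2 * e]. *)
Lemma rise_bound_binary e : d = 2%N -> 0 < e -> exists2 C, 0 <= C &
  forall s s' D, 0 <= s' -> s' <= s -> s <= 1 ->
  \sum_(i < D) p i * (1 - (1 - s') ^+ i + (s - s') ^+ i *+ (1 < i)%N) <=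
  s' - (s2 / 2 - e) * s' ^+ 2 + C * s' ^+ 3 + p 2%N * (s - s') ^+ 2
  + (s - s') ^+ 3.
Proof.
move=> d2 e0.
have [N N3 Ns2] : exists2 N, (3 <= N)%N &
    s2 - 2 * e <= \sum_(i < N) p i * (i%:R * (i%:R - 1)).
  have ls : s2 - 2 * e < s2 by lra.
  have [N _ /(_ (N + 3)%N)/=] := cvgr_ge _ (law_moment2 hp) _ ls.
  by move=> /(_ (leq_addr _ _)) h; exists (N + 3)%N; rewrite ?leq_addl.
exists (\sum_(i < N) p i * i%:R ^+ 3) => [|s s' D s0 ss s1].
  by apply: sumr_ge0 => i _; rewrite mulr_ge0 ?exprn_ge0// (law_ge0 hp).
have s01 : 0 <= s' <= 1 by lra.
set t := s - s'; have t01 : 0 <= t <= 1 by rewrite /t; lra.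
pose g i := (i%:R * (i%:R - 1) / 2 * s' ^+ 2 - i%:R ^+ 3 * s' ^+ 3) *+ (i < N)%N
   - t ^+ 2 *+ (i == 2)%N.
apply: (le_trans (@moment_bound (fun i => 1 - (1 - s') ^+ i + t ^+ i *+ (1 < i)%N)
  g N (t ^+ 3) s' 0 _ _ _ D)) => //.
- move=> i _; apply: addr_ge0; first by rewrite subr_ge0; apply: exprn_ile1; lra.
  by rewrite mulrn_wge0// exprn_ge0//; lra.
- move=> i pgt; rewrite mul0r addr0 /g.
  have h1 : 1 - (1 - s') ^+ i <= i%:R * s' -
      (i%:R * (i%:R - 1) / 2 * s' ^+ 2 - i%:R ^+ 3 * s' ^+ 3) *+ (i < N)%N.
    case: ltnP => _; first by have := expr_taylor3 i s01; rewrite mulr1n; lra.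
    by have := expr_taylor1 i s01; rewrite mulr0n; lra.
  have h2 : t ^+ i *+ (1 < i)%N <= t ^+ 3 + t ^+ 2 *+ (i == 2)%N.
    have t3 : 0 <= t ^+ 3 by rewrite exprn_ge0//; lra.
    case: i {pgt h1} => [|[|[|i]]]; rewrite ?mulr0n ?mulr1n ?addr0//=.
      by rewrite ?mulr1n lerDr.
    by rewrite ?mulr1n ?mulr0n ?addr0 ler_wiXn2l//; lra.
  by lra.
- move=> i Ni; rewrite /g ltnNge Ni /= mulr0n gtn_eqF ?mulr0n ?subr0//.
  exact: leq_trans N3 Ni.
have E : \sum_(i < N) p i * g i =
    s' ^+ 2 / 2 * (\sum_(i < N) p i * (i%:R * (i%:R - 1)))
    - (\sum_(i < N) p i * i%:R ^+ 3) * s' ^+ 3 - p 2%N * t ^+ 2.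
  have -> : p 2%N * t ^+ 2 = \sum_(i < N) p i * (t ^+ 2 *+ (i == 2 :> nat)).
    rewrite (bigD1 (Ordinal N3)) //= mulr1n big1 ?addr0// => i.
    by rewrite -val_eqE /= => /negbTE->; rewrite mulr0.
  rewrite mulr_sumr mulr_suml -!sumrB; apply: eq_bigr => i _.
  by rewrite /g ltn_ord mulr1n; ring.
have : s' ^+ 2 / 2 * (s2 - 2 * e) <=
    s' ^+ 2 / 2 * (\sum_(i < N) p i * (i%:R * (i%:R - 1))).
  by apply: ler_wpM2l => //; have := sqr_ge0 s'; lra.
by lra.
Qed.

End CriticalLaw.

(** * Recursions for the mass of trees *)

Definition HS_le (r : nat) : pred tree := fun t => (rigid_HS t <= r)%N.
Definition HS_gt (r : nat) : pred tree := fun t => ~~ HS_le r t.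
Definition height_le (k : nat) : pred tree := fun t => (tree_height t <= k)%N.

Section MassRecursion.
Variables (R : realType) (p : nat -> R).

Lemma mass_all_rec z D h (S A : pred tree) :
  (forall ts, S (Node ts) = all A ts) ->
  mass p z D h.+1 S = z * \sum_(i < D.+1) p i * mass p z D h A ^+ i.
Proof.
move=> SA; rewrite mass_words mulr_sumr; apply: eq_bigr => i _.
by rewrite -mulrA (eq_bigl _ _ SA) big_words_all.
Qed.

Lemma mass_all_diff_rec z D h (S A B : pred tree) (c : pred nat) :
  (forall t, B t -> A t) ->
  (forall ts, S (Node ts) = all A ts && ~~ (c (size ts) && all B ts)) ->
  mass p z D h.+1 S = z * \sum_(i < D.+1) p i *
    (mass p z D h A ^+ i - mass p z D h B ^+ i *+ c i).
Proof.
move=> BA SE; rewrite mass_words mulr_sumr; apply: eq_bigr => i _.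
rewrite -mulrA; congr (_ * (_ * _)).
rewrite -!big_words_all.
rewrite [X in _ = X - _]big_mkcond [X in _ = _ - X *+ _]big_mkcond.
rewrite -sumrMnl -sumrB big_mkcond big_seq [RHS]big_seq.
apply: eq_bigr => w; rewrite mem_words => /andP[/eqP szw _].
rewrite SE szw; case: (boolP (all B w)) => [aB|_].
  have -> : all A w by apply: sub_all aB.
  by case: (c i); rewrite ?mulr1n ?subrr ?mulr0n ?subr0.
by rewrite andbF andbT mul0rn subr0.
Qed.

Lemma mass_total_rec z D h :
  mass p z D h.+1 predT = z * \sum_(i < D.+1) p i * mass p z D h predT ^+ i.
Proof. by apply: mass_all_rec => ts; rewrite all_predT. Qed.

Lemma mass_HS_le0_rec z D h :
  mass p z D h.+1 (HS_le 0) = z * \sum_(i < D.+1) p i *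
    (mass p z D h (HS_le 0) ^+ i - mass p z D h (HS_le 0) ^+ i *+ (1 < i)%N).
Proof.
apply: (@mass_all_diff_rec z D h _ _ _ (leq 2)) => // ts; rewrite /HS_le rigid_HS_le.
by congr (_ && ~~ (_ && _)); apply: eq_all => t /=; rewrite leqn0.
Qed.

Lemma mass_HS_le_rec z D h r :
  mass p z D h.+1 (HS_le r.+1) = z * \sum_(i < D.+1) p i *
    (mass p z D h (HS_le r.+1) ^+ i -
     (mass p z D h (HS_le r.+1) - mass p z D h (HS_le r)) ^+ i *+ (1 < i)%N).
Proof.
have -> : mass p z D h (HS_le r.+1) - mass p z D h (HS_le r) =
    mass p z D h (fun t => HS_le r.+1 t && ~~ HS_le r t).
  rewrite (@massD _ _ _ _ _ (HS_le r) (HS_le r.+1)) 1?addrC ?addKr//.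
  by move=> t; rewrite /HS_le => /leqW.
apply: (@mass_all_diff_rec z D h _ _ _ (leq 2)) => [t /andP[]//|ts].
rewrite [LHS]rigid_HS_le; congr (_ && ~~ (_ && _)).
by apply: eq_all => t; rewrite /= rigid_HS_eq_le.
Qed.

Lemma mass_HS_gt z D h r :
  mass p z D h (HS_le r) = mass p z D h predT - mass p z D h (HS_gt r).
Proof. by rewrite [X in _ = X - _](@massD _ _ _ _ _ (HS_le r)) // addrK. Qed.

Lemma mass_HS_gt_rec z D h r :
  mass p z D h.+1 (HS_gt r.+1) = z * \sum_(i < D.+1) p i *
    (mass p z D h predT ^+ i
     - (mass p z D h predT - mass p z D h (HS_gt r.+1)) ^+ i
     + (mass p z D h (HS_gt r) - mass p z D h (HS_gt r.+1)) ^+ i *+ (1 < i)%N).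
Proof.
have -> : mass p z D h.+1 (HS_gt r.+1) =
    mass p z D h.+1 predT - mass p z D h.+1 (HS_le r.+1).
  by rewrite mass_HS_gt opprB addrC subrK.
rewrite mass_total_rec mass_HS_le_rec -mulrBr -sumrB; congr (_ * _).
apply: eq_bigr => i _; rewrite -mulrBr !mass_HS_gt; congr (_ * _).
have -> : mass p z D h predT - mass p z D h (HS_gt r.+1) -
    (mass p z D h predT - mass p z D h (HS_gt r)) =
    mass p z D h (HS_gt r) - mass p z D h (HS_gt r.+1) by ring.
by rewrite opprB addrCA [RHS]addrC addrA.
Qed.

End MassRecursion.

Section CriticalMass.
Variables (R : realType) (p : nat -> R) (s2 : R).
Hypothesis hp : critical_law p s2.
Let p_ge0 := law_ge0 hp.

Lemma mass_le1 z D h S : 0 <= z <= 1 -> mass p z D h S <= 1.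
Proof.
move=> z01; have z0 : 0 <= z by lra.
apply: (@le_trans _ _ (mass p z D h predT)); first exact: mass_sub.
elim: h => [|h IH]; first by rewrite mass0 ler01.
rewrite mass_total_rec mulr_ile1 ?sumr_ge0//; [|lra|].
  by move=> i _; rewrite mulr_ge0 ?exprn_ge0 ?mass_ge0.
by apply: (pgf_le1 hp); rewrite IH mass_ge0.
Qed.

Lemma mass_HS_gt_anti z D h r : 0 <= z ->
  mass p z D h (HS_gt r.+1) <= mass p z D h (HS_gt r).
Proof.
move=> z0; apply: mass_sub => // t; apply: contraNN.
by rewrite /HS_le => /leqW.
Qed.

Variable d : nat.
Hypothesis hd : min_branching p d.

(** A tree of number 0 never branches, so its root does not have [d] children. *)
Lemma mass_HS_le0 D h : mass p 1 D h (HS_le 0) <= 1 - p d.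
Proof.
have pd1 := law_le1 hp d.
case: h => [|h]; first by rewrite mass0; lra.
rewrite mass_HS_le0_rec mul1r; set x := mass _ _ _ _ _.
have x01 : 0 <= x <= 1 by rewrite mass_ge0 ?ler01 ?mass_le1// ?ler01 ?lexx.
apply: (le_trans (@moment_bound _ _ _ hp (fun i => x ^+ i - x ^+ i *+ (1 < i)%N)
  (fun i => 1 *+ (i == d)) d.+1 1 0 0 _ _ _ D.+1)).
- by move=> i _; case: ltnP => _; rewrite ?subrr ?subr0 ?exprn_ge0//; lra.
- move=> i _; rewrite !mul0r !addr0; case: eqP => [->|_].
    by rewrite (branch_gt1 hd) !mulr1n !subrr.
  rewrite mulr0n subr0 lerBlDr; apply: (@le_trans _ _ 1).
    by apply: exprn_ile1; lra.
  by rewrite lerDl mulrn_wge0// exprn_ge0//; lra.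
- exact: not_d.
- by rewrite sum_at_d; lra.
Qed.

(** The mass that escapes beyond [r + 1] is at least that of the roots with [d]
   children of number [r + 1] exactly, [(s - s') ^ d * p d]; it should
   compensate the convexity of the generating function. *)
Lemma mass_HS_le_step (s s' : R) r :
  (forall D h, mass p 1 D h (HS_le r) <= 1 - s) ->
  0 <= s' -> s' <= s -> s <= 1 -> s2 / 2 * s' ^+ 2 <= (s - s') ^+ d * p d ->
  forall D h, mass p 1 D h (HS_le r.+1) <= 1 - s'.
Proof.
move=> Hs s0 ss s1 cond D; elim=> [|h IH]; first by rewrite mass0; lra.
rewrite mass_HS_le_rec mul1r.
set A := mass _ _ _ _ (HS_le r.+1) in IH *; set a := mass _ _ _ _ _.
have aA : a <= A by apply: mass_sub => // t; rewrite /HS_le => /leqW.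
have a0 : 0 <= a by rewrite mass_ge0 ?ler01.
have as_ : a <= 1 - s by exact: Hs.
apply: (@le_trans _ _ (\sum_(i < D.+1) p i *
    ((1 - s') ^+ i - (s - s') ^+ i *+ (1 < i)%N))); last first.
  by apply: le_trans (no_rise_bound hp hd _ s0 ss s1) _; lra.
apply: ler_sum => i _; apply: ler_wpM2l => //; case: ltnP => _; last first.
  by rewrite !subr0; apply: lerXn2r; rewrite ?nnegrE; lra.
have h1 := expr_diff_le i a0 aA IH.
apply: le_trans h1 _; rewrite lerB//; apply: lerXn2r; rewrite ?nnegrE; lra.
Qed.

(** The recursion is monotone in the masses beyond [r] and beyond [r + 1], so any
   supersolution bounds its iterates. *)
Lemma mass_HS_gt_step (s s' : R) r :
  (forall D h, mass p 1 D h (HS_gt r) <= s) ->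
  0 <= s' -> s' <= s -> s <= 1 ->
  (forall D, \sum_(i < D) p i *
     (1 - (1 - s') ^+ i + (s - s') ^+ i *+ (1 < i)%N) <= s') ->
  forall D h, mass p 1 D h (HS_gt r.+1) <= s'.
Proof.
move=> Hs s0 ss s1 cond D; elim=> [|h IH]; first by rewrite mass0.
rewrite mass_HS_gt_rec mul1r.
set g := mass _ _ _ _ (HS_gt r.+1) in IH *.
set T := mass _ _ _ _ predT; set b := mass _ _ _ _ _.
have z01 : 0 <= (1 : R) by exact: ler01.
have gb : g <= b by exact: mass_HS_gt_anti.
have g0 : 0 <= g by exact: mass_ge0.
have bs : b <= s by exact: Hs.
have gT : g <= T by exact: mass_sub.
have T1 : T <= 1 by apply: mass_le1; rewrite z01 lexx.
apply: le_trans (cond D.+1); apply: ler_sum => i _; apply: ler_wpM2l => //.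
have h1 := expr_diff_le i g0 gT T1.
case: (ltnP 1 i) => i1 /=; last first.
  rewrite !addr0; apply: le_trans h1 _; rewrite lerB//.
  by apply: lerXn2r; rewrite ?nnegrE; lra.
have h2 : (b - g) ^+ i <= (s - g) ^+ i by apply: lerXn2r; rewrite ?nnegrE; lra.
have c1 : 0 <= 1 - s by lra.
have c2 : 1 - s <= 1 - s' by lra.
have c3 : 1 - s' <= 1 - g by lra.
have h3 := expr_diff_le i c1 c2 c3.
have E1 : 1 - s' - (1 - s) = s - s' by ring.
have E2 : 1 - g - (1 - s) = s - g by ring.
by rewrite E1 E2 in h3; rewrite expr1n in h1; rewrite !mulr1n; lra.
Qed.

(** A tree higher than [k] has a path of [k] ancestors, and all their other
   subtrees have number at most [r]: each ancestor contributes a factor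
   [G' (1 - s)], where [G] is the offspring generating function. *)
Lemma mass_high_le (s : R) r : 0 <= s <= 1 ->
  (forall D h, mass p 1 D h (HS_le r) <= 1 - s) ->
  forall D k h, mass p 1 D h (fun t => HS_le r t && ~~ height_le k t)
    <= (1 - s * p d) ^+ k.
Proof.
move=> s01 Hs D; have z01 : 0 <= (1 : R) by exact: ler01.
have rho0 : 0 <= 1 - s * p d.
  by apply: le_trans (pgf_deriv_le hp hd 0 s01); rewrite big_ord0.
elim=> [|k IH] [|h]; rewrite ?mass0 ?exprn_ge0//.
  by rewrite expr0 mass_le1// z01 lexx.
pose A := HS_le r; pose B := fun t => HS_le r t && height_le k t.
apply: (@le_trans _ _ (1 * \sum_(i < D.+1) p i *
    (mass p 1 D h A ^+ i - mass p 1 D h B ^+ i))).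
  rewrite -(@mass_all_diff_rec _ _ _ _ _ (fun t => let: Node ts := t in
    all A ts && ~~ all B ts) _ _ xpredT) //; last by move=> t /andP[].
  apply: mass_sub => // -[ts] /andP[]; rewrite [HS_le _ _]rigid_HS_le.
  move=> /andP[aA _]; rewrite aA /= /height_le tree_height_le.
  by apply: contraNN => aB; apply: sub_all aB => t /andP[].
have BA t : B t -> A t by case/andP.
have := @massD _ p 1 D h B A BA.
set a := mass _ _ _ _ A; set b := mass _ _ _ _ B; set e := mass _ _ _ _ _ => E.
have e0 : 0 <= e by exact: mass_ge0.
have b0 : 0 <= b by exact: mass_ge0.
have as_ : a <= 1 - s by exact: Hs.
have eI : e <= (1 - s * p d) ^+ k.
  apply: le_trans (IH h); apply: mass_sub => // t /andP[At].
  by rewrite /B -/(A t) At.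
rewrite mul1r exprS.
apply: (@le_trans _ _ (e * \sum_(i < D.+1) p i * (i%:R * (1 - s) ^+ i.-1))).
  rewrite mulr_sumr; apply: ler_sum => i _.
  rewrite mulrCA; apply: ler_wpM2l => //.
  have eb : e <= a by lra.
  have -> : b = a - e by lra.
  apply: le_trans (expr_diff_deriv _ e0 eb) _.
  apply: ler_wpM2l => //; apply: ler_wpM2l => //.
  by apply: lerXn2r; rewrite ?nnegrE; lra.
rewrite mulrC; apply: ler_pM => //; last exact: (pgf_deriv_le hp hd).
by apply: sumr_ge0 => i _; rewrite !mulr_ge0 ?exprn_ge0//; lra.
Qed.

End CriticalMass.

(** * Tail bounds for trees of a given size *)

Section SizedMass.
Variables (R : realType) (p : nat -> R).

Definition sized (n : nat) (S : pred tree) : R :=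
  mass p 1 n n (fun t => (tree_size t == n) && S t).

Hypothesis p_ge0 : forall i, 0 <= p i.

Lemma sized_ge0 n S : 0 <= sized n S.
Proof. by apply: mass_ge0. Qed.

Lemma sized_weight z n S : 0 <= z -> z ^+ n * sized n S <= mass p z n n S.
Proof.
move=> z0; rewrite mulr_sumr.
apply: (@le_trans _ _ (mass p z n n (fun t => (tree_size t == n) && S t))).
  rewrite /mass le_eqVlt; apply/orP; left; apply/eqP.
  by apply: eq_bigr => t /andP[/eqP szt _]; rewrite [RHS]weight_size szt.
by apply: mass_sub => // t /andP[].
Qed.

Lemma mass_le_mass1 z D h S : 0 <= z <= 1 -> mass p z D h S <= mass p 1 D h S.
Proof.
move=> /andP[z0 z1]; apply: ler_sum => t _; rewrite weight_size.
by rewrite ler_piMl ?weight_ge0// exprn_ile1.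
Qed.

End SizedMass.

Section TailBounds.
Variables (R : realType) (p : nat -> R) (s2 : R) (d : nat).
Hypothesis hp : critical_law p s2.
Hypothesis hd : min_branching p d.
Let p_ge0 := law_ge0 hp.

(** Comparison with the critical recursion [y -> y - s2 / 2 * y ^ 2] of the
   survival probabilities, whose solution is of order [1 / k]: tilting sizes
   by a factor [1 + eta] is harmless up to height [eta ^ (- 1 / 2)]. *)
Lemma mass_short_le (K eta : R) N D h k : 1 <= K -> 2 * s2 <= K ->
  0 <= eta -> 4 * K * N%:R ^+ 2 * eta <= 1 -> (k <= N)%N ->
  mass p (1 + eta) D h (height_le k) <= 1 - (K * k.+1%:R)^-1.
Proof.
move=> K1 Ks e0 eN; elim: k h => [|k IH] h kN.
  rewrite [mass _ _ _ _ _](_ : _ = 0); last by rewrite /mass big1_seq// => -[ts] /andP[].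
  by rewrite mulr1 subr_ge0 invf_le1 //; lra.
have K0 : 0 < K by lra.
have q1 : 1 <= k.+1%:R :> R by rewrite ler1n.
have eq2 : k.+2%:R = k.+1%:R + 1 :> R by rewrite -natr1.
rewrite eq2 {eq2}.
have qN : k.+1%:R <= N%:R :> R by rewrite ler_nat.
move: (k.+1%:R) q1 qN IH => q q1 qN IH.
have q0 : 0 < q by lra.
have Kq : 1 <= K * q by rewrite -[1]mulr1 ler_pM.
set y := (K * q)^-1 in IH.
have y0 : 0 < y by rewrite invr_gt0 mulr_gt0.
have y01 : 0 <= y <= 1 by rewrite ltW//= invf_le1 ?mulr_gt0.
have y'y : (K * (q + 1))^-1 <= y - K * y ^+ 2 / 2.
  have -> : y - K * y ^+ 2 / 2 = (K * (q + 1))^-1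
      + (q - 1) / (2 * K * q ^+ 2 * (q + 1)).
    by rewrite /y; field; rewrite !gt_eqF//; lra.
  rewrite lerDl divr_ge0 ?mulr_ge0 ?sqr_ge0//; lra.
have yK1 : K * y ^+ 2 <= y.
  have -> : K * y ^+ 2 = y / q by rewrite /y; field; rewrite !gt_eqF.
  by rewrite ler_pdivrMr// ler_peMr// ltW.
have eta_le : eta <= K * y ^+ 2 / 4.
  have -> : K * y ^+ 2 / 4 = 1 / (4 * K * q ^+ 2).
    by rewrite /y; field; rewrite !gt_eqF.
  rewrite ler_pdivlMr ?mulr_gt0 ?exprn_gt0//; apply: le_trans eN.
  rewrite mulrC ler_wpM2r// ler_wpM2l//; first by lra.
  by apply: lerXn2r; rewrite ?nnegrE; lra.
have Ky0 : 0 <= K * y ^+ 2 by rewrite mulr_ge0 ?sqr_ge0//; lra.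
case: h => [|h]; first by rewrite mass0; lra.
rewrite (@mass_all_rec _ _ _ _ _ _ (height_le k)); last first.
  by move=> ts; exact: tree_height_le.
set m := mass _ _ _ _ _.
have m0 : 0 <= m by apply: mass_ge0 => //; lra.
have my : m <= 1 - y by apply: IH; exact: ltnW.
have G : \sum_(i < D.+1) p i * m ^+ i <= 1 - y + s2 / 2 * y ^+ 2.
  apply: le_trans (pgf_le hp D.+1 y01); apply: ler_sum => i _.
  by apply: ler_wpM2l => //; apply: lerXn2r; rewrite ?nnegrE; lra.
apply: (@le_trans _ _ ((1 + eta) * (1 - y + s2 / 2 * y ^+ 2))).
  by apply: ler_wpM2l => //; lra.
have sy : s2 / 2 * y ^+ 2 <= K / 4 * y ^+ 2.
  by apply: ler_wpM2r; [exact: sqr_ge0 | lra].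
have h1 : eta * (1 - y + s2 / 2 * y ^+ 2) <= eta * 1.
  by apply: ler_wpM2l => //; lra.
by lra.
Qed.

Lemma sized_short_le (K : R) n k : 1 <= K -> 2 * s2 <= K -> (0 < k)%N ->
  sized p n (height_le k) <= (1 + (4 * K * k%:R ^+ 2)^-1) ^- n.
Proof.
move=> K1 Ks k0; set eta := (4 * K * k%:R ^+ 2)^-1.
have k0' : 0 < k%:R :> R by rewrite ltr0n.
have eta0 : 0 < eta by rewrite invr_gt0 !mulr_gt0 ?exprn_gt0//; lra.
have z0 : 0 < (1 + eta) ^+ n by rewrite exprn_gt0//; lra.
rewrite -[leRHS]mul1r ler_pdivlMr// mulrC.
apply: (@le_trans _ _ (mass p (1 + eta) n n (height_le k))).
  by apply: sized_weight => //; lra.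
apply: le_trans (@mass_short_le K eta k _ _ _ K1 Ks (ltW eta0) _ (leqnn k)) _.
  by rewrite /eta divff// gt_eqF// !mulr_gt0 ?exprn_gt0//; lra.
by rewrite gerBl invr_ge0 mulr_ge0//; lra.
Qed.

(** A tree of size [n] and number at most [r] is either higher than [k], which
   its number makes unlikely, or short, which its size makes unlikely. *)
Lemma sized_HS_le (K s : R) r n k : 1 <= K -> 2 * s2 <= K -> (0 < k)%N ->
  0 <= s <= 1 -> (forall D h, mass p 1 D h (HS_le r) <= 1 - s) ->
  sized p n (HS_le r) <=
    (1 - s * p d) ^+ k + (1 + (4 * K * k%:R ^+ 2)^-1) ^- n.
Proof.
move=> K1 Ks k0 s01 Hs.
apply: le_trans (lerD (mass_high_le hp hd s01 Hs n k n)
  (sized_short_le n K1 Ks k0)); rewrite addrC.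
rewrite /sized (@massD _ _ _ _ _
  (fun t => (tree_size t == n) && (HS_le r t && height_le k t))); last first.
  by move=> t /andP[-> /andP[->]].
apply: lerD; first by apply: mass_sub => // t /andP[-> /andP[]].
apply: mass_sub => // t /andP[/andP[szt Rt]]; rewrite szt Rt /=.
by move=> ->.
Qed.

Section Subcritical.
Variables (n : nat) (y : R).
Hypotheses (n0 : (0 < n)%N) (y0 : 0 < y) (y2 : y <= 1 / 2).
Hypothesis yn : s2 / 2 * y ^+ 2 <= (4 * n%:R)^-1.
Let z : R := 1 - (2 * n%:R)^-1.

Local Lemma n_ge1 : 1 <= n%:R :> R. Proof. by rewrite ler1n. Qed.

Local Lemma tilt_half : (4 * n%:R)^-1 = (2 * n%:R)^-1 / 2 :> R.
Proof. have h : 0 < n%:R :> R by rewrite ltr0n. by field; rewrite gt_eqF. Qed.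

Local Lemma tilt_le : 0 < (2 * n%:R : R)^-1 <= 2^-1.
Proof.
have n1 := n_ge1; have h : 0 < 2 * n%:R :> R by lra.
by rewrite invr_gt0 h /= lef_pV2 ?posrE//; lra.
Qed.

(** For small tilts the fixed point of the tilted generating function lies below
   1 by the square root of the tilt; [y] is a lower bound for this gap. *)
Lemma mass_subcritical D h : mass p z D h predT <= 1 - y.
Proof.
have y01 : 0 <= y <= 1 by have h0 := y0; have h2 := y2; lra.
have e0 := tilt_le.
elim: h => [|h IH]; first by rewrite mass0; lra.
rewrite mass_total_rec; set m := mass _ _ _ _ _ in IH *.
have z0 : 0 <= z by rewrite /z; lra.
have m0 : 0 <= m by apply: mass_ge0.
have G : \sum_(i < D.+1) p i * m ^+ i <= 1 - y + s2 / 2 * y ^+ 2.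
  apply: le_trans (pgf_le hp D.+1 y01); apply: ler_sum => i _.
  by apply: ler_wpM2l => //; apply: lerXn2r; rewrite ?nnegrE; lra.
have s2y : 0 <= s2 / 2 * y ^+ 2.
  rewrite mulr_ge0 ?sqr_ge0// divr_ge0//.
  by apply: le_trans (variance_ge hp 0); rewrite big_ord0.
apply: le_trans (ler_wpM2l z0 G) _; have h2 := y2; have hn := yn; rewrite tilt_half in hn.
have h1 : (2 * n%:R)^-1 * 2^-1 <= (2 * n%:R)^-1 * (1 - y + s2 / 2 * y ^+ 2).
  by apply: ler_wpM2l; lra.
by rewrite /z; lra.
Qed.

(** Below criticality a path of ancestors costs a factor [1 - y * p d] per
   generation, so its mean length is at most [(y * p d)^-1]; at its end a node
   exceeds [r + 1] because at least two children exceed [r]. *)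
Lemma mass_HS_gt_square (x : R) r : 0 <= x ->
  (forall D h, mass p z D h (HS_gt r) <= x) ->
  forall D h, mass p z D h (HS_gt r.+1) <= x ^+ 2 / (y * p d).
Proof.
move=> x0 Hx D.
have pd0 := branch_gt0 hd; have e0 := tilt_le.
have kap0 : 0 < y * p d by rewrite mulr_gt0.
have z01 : 0 <= z <= 1 by rewrite /z; lra.
have z0 : 0 <= z by lra.
have y01 : 0 <= y <= 1 by have h0 := y0; have h2 := y2; lra.
elim=> [|h IH]; first by rewrite mass0 divr_ge0 ?sqr_ge0// ltW.
rewrite mass_HS_gt_rec.
set g := mass _ _ _ _ (HS_gt r.+1) in IH *.
have Ty := mass_subcritical D h.
set T := mass _ _ _ _ predT in Ty *; set b := mass _ _ _ _ _.
have gb : g <= b by exact: (mass_HS_gt_anti hp).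
have g0 : 0 <= g by exact: mass_ge0.
have bx : b <= x by exact: Hx.
have b1 : b <= 1 by apply: (mass_le1 hp).
have gT : g <= T by exact: mass_sub.
have b2 : b ^+ 2 <= x ^+ 2 by apply: lerXn2r; rewrite ?nnegrE; lra.
have kap1 : 0 <= 1 - y * p d.
  by apply: le_trans (pgf_deriv_le hp hd 0 y01); rewrite big_ord0.
set q := x ^+ 2 / (y * p d) in IH *.
have qE : q * (1 - y * p d) + x ^+ 2 = q.
  by rewrite /q; field; rewrite !gt_eqF.
set S := \sum_(i < _) _.
have S0 : 0 <= S.
  apply: sumr_ge0 => i _; apply: mulr_ge0 => //; apply: addr_ge0.
    by rewrite subr_ge0; apply: lerXn2r; rewrite ?nnegrE; lra.
  by rewrite mulrn_wge0// exprn_ge0//; lra.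
apply: (@le_trans _ _ S); first by rewrite ler_piMl//; lra.
apply: (@le_trans _ _ (g * (\sum_(i < D.+1) p i * (i%:R * (1 - y) ^+ i.-1))
   + x ^+ 2 * (\sum_(i < D.+1) p i * 1 ^+ i))).
  rewrite !mulr_sumr -big_split; apply: ler_sum => i _ /=.
  rewrite [g * _]mulrCA [x ^+ 2 * _]mulrCA -mulrDr; apply: ler_wpM2l => //.
  apply: lerD.
    apply: le_trans (expr_diff_deriv _ g0 gT) _.
    apply: ler_wpM2l => //; apply: ler_wpM2l => //.
    by apply: lerXn2r; rewrite ?nnegrE; lra.
  rewrite expr1n mulr1; case: ltnP => i1 /=; last by rewrite sqr_ge0.
  apply: le_trans b2; apply: (@le_trans _ _ (b ^+ i)).
    by apply: lerXn2r; rewrite ?nnegrE; lra.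
  by rewrite ler_wiXn2l//; lra.
rewrite -[leRHS]qE; apply: lerD.
  apply: ler_pM => //; last exact: (pgf_deriv_le hp hd).
  by apply: sumr_ge0 => i _; rewrite !mulr_ge0 ?exprn_ge0//; lra.
by rewrite ler_piMr ?sqr_ge0//; apply: (pgf_le1 hp); rewrite ler01 lexx.
Qed.

Lemma mass_HS_gt_iter (x : R) r j : 0 <= x ->
  (forall D h, mass p z D h (HS_gt r) <= y * p d * x) ->
  forall D h, mass p z D h (HS_gt (r + j)) <= y * p d * x ^+ (2 ^ j).
Proof.
move=> x0; elim: j => [|j IH] Hx D h; first by rewrite addn0 expn0 expr1.
have kap0 : 0 < y * p d by rewrite mulr_gt0// (branch_gt0 hd).
rewrite addnS; apply: le_trans (mass_HS_gt_square _ (IH Hx) _ _) _.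
  by rewrite mulr_ge0 ?exprn_ge0// ltW.
rewrite expnSr exprM le_eqVlt; apply/orP; left; apply/eqP; field.
by rewrite !gt_eqF// (branch_gt0 hd).
Qed.

(** The tilt [z] satisfies [z ^ n >= 1 / 2], whence the factor 2. *)
Lemma sized_HS_gt (x : R) r j : 0 <= x ->
  (forall D h, mass p 1 D h (HS_gt r) <= y * p d * x) ->
  sized p n (HS_gt (r + j)) <= 2 * (y * p d * x ^+ (2 ^ j)).
Proof.
move=> x0 Hx; have e0 := tilt_le; have n1 := n_ge1.
have z01 : 0 <= z <= 1 by rewrite /z; lra.
have zn : 2^-1 <= z ^+ n.
  have -> : 2^-1 = 1 - n%:R * (2 * n%:R)^-1 :> R.
    by field; rewrite gt_eqF//; lra.
  by apply: expr_taylor1; lra.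
have h1 : mass p z n n (HS_gt (r + j)) <= y * p d * x ^+ (2 ^ j).
  apply: mass_HS_gt_iter => // D h.
  by apply: le_trans (mass_le_mass1 p_ge0 _ _ _ z01) (Hx D h).
have z0 : 0 <= z by lra.
have h2 := sized_weight p_ge0 n (HS_gt (r + j)) z0.
have h3 : 2^-1 * sized p n (HS_gt (r + j)) <= z ^+ n * sized p n (HS_gt (r + j)).
  by apply: ler_wpM2r => //; exact: sized_ge0.
by lra.
Qed.

End Subcritical.
End TailBounds.

(** * The law of the number of an unconditioned tree *)

Section Decay.
Variables (R : realType) (p : nat -> R) (s2 : R) (d : nat).
Hypothesis hp : critical_law p s2.
Hypothesis hd : min_branching p d.
Let p_ge0 := law_ge0 hp.

Lemma variance_gt0 : 0 < s2.
Proof.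
apply: lt_le_trans (variance_ge hp d.+1); rewrite big_ord_recr /=.
apply: ltr_wpDl.
  apply: sumr_ge0 => -[[|i] lti] _ /=; first by rewrite mul0r mulr0.
  by rewrite -natr1 addrK !mulr_ge0.
have := branch_gt1 hd; case: (d) (branch_gt0 hd) => [|[|e]] // pd _.
by rewrite -[e.+2%:R]natr1 addrK !mulr_gt0// ?natr1 ltr0n.
Qed.

(** A crude geometric bound, valid from the first level on; it brings the tail
   into the range where Taylor expansions are sharp.  The ratio is the one for
   which [(s - s') ^ 2 = p d * s' ^ 2]. *)
Lemma mass_HS_gt_crude r D h :
  mass p 1 D h (HS_gt r) <= (1 + Num.sqrt (p d)) ^- r.
Proof.
set q := Num.sqrt (p d); have q0 : 0 < q by rewrite sqrtr_gt0 (branch_gt0 hd).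
have q2 : q ^+ 2 = p d by rewrite sqr_sqrtr.
elim: r D h => [|r IH] D h.
  by rewrite expr0 invr1 (mass_le1 hp)// ler01 lexx.
move: D h; apply: (mass_HS_gt_step hp IH).
- by rewrite invr_ge0 exprn_ge0//; lra.
- by rewrite lef_pV2 ?posrE ?exprn_gt0//; try lra; rewrite exprS ler_peMl ?exprn_ge0//; lra.
- by rewrite invf_le1 ?exprn_ege1 ?exprn_gt0//; lra.
move=> D; set s := (_ ^- r); set s' := (_ ^- r.+1).
have s0 : 0 < s by rewrite invr_gt0 exprn_gt0//; lra.
have s1 : s <= 1 by rewrite invf_le1 ?exprn_ege1 ?exprn_gt0//; lra.
have E : s = s' * (1 + q).
  by rewrite /s /s' exprS; field; rewrite !gt_eqF ?exprn_gt0//; lra.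
have s'0 : 0 < s' by rewrite invr_gt0 exprn_gt0//; lra.
have ss : s' <= s by rewrite E ler_peMr; lra.
apply: le_trans (rise_bound hp hd _ (ltW s'0) ss s1) _.
have : (s - s') ^+ d <= (s - s') ^+ 2.
  by rewrite ler_wiXn2l ?(branch_gt1 hd)//; lra.
have -> : (s - s') ^+ 2 = s' ^+ 2 * p d by rewrite E -q2; ring.
by lra.
Qed.

Lemma mass_HS_gt_small (e : R) : 0 < e ->
  exists r, forall D h, mass p 1 D h (HS_gt r) <= e.
Proof.
move=> e0; set q := Num.sqrt (p d).
have q0 : 0 < q by rewrite sqrtr_gt0 (branch_gt0 hd).
have q1 : `|(1 + q)^-1| < 1.
  by rewrite ger0_norm ?invr_ge0 ?invf_lt1; lra.
have [r _ /(_ r (leqnn r)) /= H] := cvgr0_norm_le _ (cvg_expr q1) _ e0.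
exists r => D h; apply: le_trans (mass_HS_gt_crude r D h) _.
by rewrite -exprVn; apply: le_trans H; exact: ler_norm.
Qed.

Section Binary.
Hypothesis d2 : d = 2%N.
Let gamma := 1 + Num.sqrt (s2 / (2 * p 2%N)).

Lemma gamma_gt1 : 1 < gamma.
Proof.
rewrite /gamma ltrDl sqrtr_gt0 divr_gt0 ?variance_gt0//.
by rewrite mulr_gt0// -d2 (branch_gt0 hd).
Qed.

Lemma gamma_sqr : p 2%N * (gamma - 1) ^+ 2 = s2 / 2.
Proof.
have p0 : 0 < p 2%N by rewrite -d2 (branch_gt0 hd).
rewrite /gamma addrC addKr sqr_sqrtr; first by field; rewrite gt_eqF.
by rewrite divr_ge0 ?mulr_ge0 // ltW// variance_gt0.
Qed.

(** Here [p 2 * gamma ^- r] is an exact solution of the limit equation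
   [s2 / 2 * s' ^ 2 = p 2 * (s - s') ^ 2]. *)
Lemma mass_HS_le_binary r D h :
  mass p 1 D h (HS_le r) <= 1 - p 2%N * gamma ^- r.
Proof.
have g1 := gamma_gt1.
have p0 : 0 < p 2%N by rewrite -d2 (branch_gt0 hd).
have p1 : p 2%N <= 1 by exact: (law_le1 hp).
elim: r D h => [|r IH] D h.
  by rewrite expr0 invr1 mulr1 -d2; exact: (mass_HS_le0 hp hd).
have gr : 1 <= gamma ^+ r by apply: exprn_ege1; lra.
have gV : 0 < gamma ^- r by rewrite invr_gt0; lra.
have gV1 : gamma ^- r <= 1 by rewrite invf_le1; lra.
have E : gamma ^- r = gamma ^- r.+1 * gamma.
  by rewrite exprS; field; rewrite !gt_eqF//; lra.
have gS : 0 < gamma ^- r.+1 by rewrite invr_gt0 exprn_gt0//; lra.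
move: D h; apply: (mass_HS_le_step hp hd IH).
- by rewrite mulr_ge0// ltW.
- by rewrite ler_pM2l// E ler_peMr; lra.
- by rewrite mulr_ile1//; lra.
rewrite {1}d2 d2 E -gamma_sqr le_eqVlt; apply/orP; left; apply/eqP; ring.
Qed.

(** Any ratio below [gamma] leaves a margin [e] in the quadratic terms, which
   absorbs the cubic ones as soon as the tail is small enough. *)
Lemma mass_HS_gt_binary (g : R) : 1 < g -> g < gamma ->
  exists2 C, 0 < C & forall r D h, mass p 1 D h (HS_gt r) <= C * g ^- r.
Proof.
move=> g1 ggamma; have p0 : 0 < p 2%N by rewrite -d2 (branch_gt0 hd).
pose e := (s2 / 2 - p 2%N * (g - 1) ^+ 2) / 2.
have e0 : 0 < e.
  rewrite divr_gt0// -gamma_sqr -mulrBr mulr_gt0// subr_gt0.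
  by rewrite ltr_pXn2r ?nnegrE//; lra.
have [C C0 HC] := rise_bound_binary hp d2 e0.
pose B := C + (g - 1) ^+ 3 + e.
have B0 : 0 < B.
  have : 0 <= (g - 1) ^+ 3 by rewrite exprn_ge0//; lra.
  by rewrite /B; lra.
have [r0 Hr0] := mass_HS_gt_small (divr_gt0 e0 B0).
have eB1 : e / B <= 1.
  rewrite ler_pdivrMr// mul1r /B.
  have g3 : 0 <= (g - 1) ^+ 3 by rewrite exprn_ge0//; lra.
  by lra.
have Hk k D h : mass p 1 D h (HS_gt (r0 + k)) <= e / B * g ^- k.
  elim: k D h => [|k IH] D h; first by rewrite addn0 expr0 invr1 mulr1.
  have gr : 1 <= g ^+ k by apply: exprn_ege1; lra.
  have gV : 0 < g ^- k by rewrite invr_gt0; lra.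
  have gV1 : g ^- k <= 1 by rewrite invf_le1; lra.
  have E : g ^- k = g ^- k.+1 * g.
    by rewrite exprS; field; rewrite !gt_eqF//; lra.
  have gS : 0 < g ^- k.+1 by rewrite invr_gt0 exprn_gt0//; lra.
  have eB0 : 0 < e / B by rewrite divr_gt0.
  have ss : e / B * g ^- k.+1 <= e / B * g ^- k.
    by rewrite ler_pM2l// E ler_peMr; lra.
  have s1 : e / B * g ^- k <= 1 by rewrite mulr_ile1//; lra.
  have s0 : 0 <= e / B * g ^- k.+1 by rewrite mulr_ge0; lra.
  rewrite addnS; move: D h; apply: (mass_HS_gt_step hp IH) => // D.
  apply: le_trans (HC _ _ D s0 ss s1) _.
  set s' := e / B * g ^- k.+1 in ss s0 *.
  have Es : e / B * g ^- k = s' * g by rewrite E /s'; ring.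
  rewrite Es.
  have s'le : s' <= e / B by apply: le_trans ss _; rewrite ler_piMr; lra.
  have : s' ^+ 2 * (s' * B) <= s' ^+ 2 * e.
    by apply: ler_wpM2l; [exact: sqr_ge0 | rewrite -ler_pdivlMr].
  have : 0 <= s' ^+ 3 by rewrite exprn_ge0.
  have -> : s' * g - s' = s' * (g - 1) by ring.
  rewrite /B => h3 h2.
  have h4 : s' ^+ 2 * e * 2 = s' ^+ 2 * (s2 / 2) - s' ^+ 2 * (p 2%N * (g - 1) ^+ 2).
    by rewrite /e; field.
  have h5 : 0 <= s' ^+ 3 * e by rewrite mulr_ge0//; lra.
  have h6 : (s' * (g - 1)) ^+ 3 = s' ^+ 3 * (g - 1) ^+ 3 by rewrite exprMn.
  have h7 : (s' * (g - 1)) ^+ 2 = s' ^+ 2 * (g - 1) ^+ 2 by rewrite exprMn.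
  rewrite h6 h7.
  have h8 : s' ^+ 2 * (s' * (C + (g - 1) ^+ 3 + e)) =
     C * s' ^+ 3 + s' ^+ 3 * (g - 1) ^+ 3 + s' ^+ 3 * e by ring.
  rewrite h8 in h2; lra.
exists (g ^+ r0) => [|r D h]; first by rewrite exprn_gt0//; lra.
have [rr0|r0r] := ltnP r r0.
  apply: le_trans (mass_le1 hp _ _ _ _) _; first by rewrite ler01 lexx.
  rewrite -(subnK (ltnW rr0)) exprD mulfK ?gt_eqF ?exprn_gt0//; last by lra.
  by apply: exprn_ege1; lra.
rewrite -(subnKC r0r); apply: le_trans (Hk _ _ _) _.
rewrite exprD invfM mulrA divff ?gt_eqF ?exprn_gt0//; last by lra.
by apply: ler_wpM2r => //; rewrite invr_ge0 exprn_ge0//; lra.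
Qed.

End Binary.

Section NonBinary.
Hypothesis d3 : (2 < d)%N.
Let lam : R := d%:R / 2.

Lemma lam_gt1 : 1 < lam.
Proof. by rewrite /lam ltr_pdivlMr// mul1r ltr_nat. Qed.

Lemma expR_half_power (u : R) : expR (- u) ^+ d = expR (- (lam * u)) ^+ 2.
Proof.
by rewrite -!expRM_natl; congr expR; rewrite /lam; field.
Qed.

(** On a logarithmic scale the step multiplies by [lam] and subtracts [a], with
   fixed point [v]; a tail once below [exp (- v)] thus moves away from it
   geometrically. *)
Lemma mass_HS_gt_nonbinary : exists r0, forall r D h,
  mass p 1 D h (HS_gt (r0 + r)) <= expR (- lam ^+ r).
Proof.
have l1 := lam_gt1; have p0 := branch_gt0 hd; have p1 := law_le1 hp d.
pose a := - ln (p d) / 2.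
have a0 : 0 <= a by rewrite /a divr_ge0// oppr_ge0 ln_le0.
have ea : expR (- a) ^+ 2 = p d.
  by rewrite -expRM_natl /a mulNr opprK mulrCA divff// mulr1 lnK ?posrE.
pose v := a / (lam - 1).
have v0 : 0 <= v by rewrite divr_ge0//; lra.
have vE : lam * v - a = v by rewrite /v; field; rewrite gt_eqF//; lra.
have [r0 Hr0] := mass_HS_gt_small (expR_gt0 (- (v + 1))).
exists r0; suff H : forall r D h,
    mass p 1 D h (HS_gt (r0 + r)) <= expR (- (v + lam ^+ r)).
  by move=> r D h; apply: le_trans (H r D h) _; rewrite ler_expR; lra.
elim=> [|r IH] D h; first by rewrite addn0 expr0.
have lr : 1 <= lam ^+ r by apply: exprn_ege1; lra.
have lS : lam ^+ r <= lam ^+ r.+1 by rewrite exprS ler_peMl; lra.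
have ss : expR (- (v + lam ^+ r.+1)) <= expR (- (v + lam ^+ r)).
  by rewrite ler_expR; lra.
have s1 : expR (- (v + lam ^+ r)) <= 1 by rewrite -expR0 ler_expR; lra.
rewrite addnS; move: D h; apply: (mass_HS_gt_step hp IH) => // D.
apply: le_trans (rise_bound hp hd _ (expR_ge0 _) ss s1) _.
set s := expR (- (v + lam ^+ r)) in ss s1 *.
set s' := expR (- (v + lam ^+ r.+1)) in ss *.
suff : (s - s') ^+ d <= s' ^+ 2 * p d by lra.
have s'0 : 0 < s' by exact: expR_gt0.
apply: (@le_trans _ _ (s ^+ d)).
  by apply: lerXn2r; rewrite ?nnegrE; lra.
rewrite /s expR_half_power.
have -> : - (lam * (v + lam ^+ r)) = - (v + lam ^+ r.+1) - a.
  by rewrite exprS mulrDr; lra.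
by rewrite expRD exprMn -/s' ea.
Qed.

(** The same affine recursion with the opposite sign: [b] is large enough for the
   tail to at least halve at each step and for [s'] to stay below the escaping
   mass. *)
Lemma mass_HS_le_nonbinary : exists2 C, 0 <= C & forall r D h,
  mass p 1 D h (HS_le r) <= 1 - expR (- (C * lam ^+ r)).
Proof.
have l1 := lam_gt1; have p0 := branch_gt0 hd; have p1 := law_le1 hp d.
have s20 := variance_gt0.
pose b := Num.max (ln 2) (ln (s2 / 2 * 2 ^+ d / p d) / 2).
have b2 : expR (- b) <= 2^-1.
  by rewrite expRN lef_pV2 ?posrE ?expR_gt0// -[leLHS]lnK ?posrE// ler_expR le_max lexx.
have b0 : 0 < b by rewrite lt_max ln_gt0// ltr1n.
have bs : s2 / 2 * expR (- b) ^+ 2 <= 2^-1 ^+ d * p d.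
  rewrite -expRM_natl mulrN expRN ler_pdivrMr ?expR_gt0//.
  rewrite -ler_pdivrMl ?mulr_gt0 ?exprn_gt0 ?invr_gt0//.
  have E : (2^-1 ^+ d * p d)^-1 * (s2 / 2) = s2 / 2 * 2 ^+ d / p d.
    by rewrite exprVn; field; rewrite !gt_eqF ?exprn_gt0.
  rewrite E -[leLHS]lnK; last by rewrite posrE !mulr_gt0 ?invr_gt0 ?exprn_gt0.
  by rewrite ler_expR -ler_pdivrMl// mulrC le_max lexx orbT.
pose v := b / (lam - 1).
have v0 : 0 <= v by rewrite divr_ge0//; lra.
have vE : lam * v - b = v by rewrite /v; field; rewrite gt_eqF//; lra.
pose u := - ln (p d).
have u0 : 0 <= u by rewrite oppr_ge0 ln_le0.
have C0 : 0 <= u + v by lra.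
exists (u + v) => //; suff H : forall r D h,
    mass p 1 D h (HS_le r) <= 1 - expR (- ((u + v) * lam ^+ r - v)).
  move=> r D h; apply: le_trans (H r D h) _.
  by rewrite lerB// ler_expR; lra.
elim=> [|r IH] D h.
  rewrite expr0 mulr1 addrK opprK lnK ?posrE//.
  exact: (mass_HS_le0 hp hd).
have lr : 1 <= lam ^+ r by apply: exprn_ege1; lra.
set w := (u + v) * lam ^+ r - v in IH *.
have w0 : 0 <= w by rewrite /w; have := ler_wpM2l C0 lr; lra.
have -> : (u + v) * lam ^+ r.+1 - v = lam * w + b.
  by rewrite /w exprS; lra.
have half : expR (- (lam * w + b)) <= expR (- w) / 2.
  rewrite opprD expRD; apply: ler_pM; rewrite ?expR_ge0// ler_expR lerN2.
  by rewrite ler_peMl//; lra.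
have e0 : 0 < expR (- w) by exact: expR_gt0.
have e1 : expR (- w) <= 1 by rewrite -expR0 ler_expR; lra.
move: D h; apply: (mass_HS_le_step hp hd IH) => //; first by lra.
apply: (@le_trans _ _ ((expR (- w) / 2) ^+ d * p d)); last first.
  by apply: ler_wpM2r => //; apply: lerXn2r; rewrite ?nnegrE; lra.
rewrite exprMn expR_half_power opprD expRD exprMn -[leRHS]mulrA.
rewrite mulrCA; apply: ler_wpM2l; first by rewrite exprn_ge0// expR_ge0.
exact: bs.
Qed.

End NonBinary.
End Decay.

(** * The cycle lemma *)

Fixpoint preorder (t : tree) : seq nat :=
  let: Node ts := t in size ts :: flatten (map preorder ts).

Lemma size_preorder t : size (preorder t) = tree_size t.
Proof.
elim/tree_ind_mem: t => ts IH /=; rewrite size_flatten /shape -map_comp.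
by congr (sumn _).+1; apply/eq_in_map => t /IH.
Qed.

Lemma sumn_preorder t : (sumn (preorder t)).+1 = tree_size t.
Proof.
elim/tree_ind_mem: t => ts IH /=; congr _.+1.
elim: ts IH => //= t ts IHts IH.
have IH' s : s \in ts -> (sumn (preorder s)).+1 = tree_size s.
  by move=> sts; rewrite IH// in_cons sts orbT.
have := IHts IH'; have := IH t (mem_head _ _).
by rewrite sumn_cat => <- <-; lia.
Qed.

Lemma weight_preorder (R : realType) (p : nat -> R) t :
  weight p 1 t = \prod_(x <- preorder t) p x.
Proof.
elim/tree_ind_mem: t => ts IH; rewrite weightE mul1r /= big_cons; congr (_ * _).
by rewrite big_flatten big_map; apply: eq_big_seq => t /IH.
Qed.

(** Reading a word from the right and stacking the subtrees already read
   decodes a forest, as long as the stack never runs short. *)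
Lemma decode_forest (w : seq nat) (k : nat) : (sumn w + k)%N = size w ->
  (forall i, (i < size w)%N -> (sumn (drop i w) < size (drop i w))%N) ->
  exists2 ts, size ts = k & flatten (map preorder ts) = w.
Proof.
elim: w k => [|x w IH] k /=; first by move=> k0 _; exists [::].
move=> xwk H.
have lew : (sumn w <= size w)%N.
  case: w H {IH xwk} => // y w H.
  by apply: ltnW; exact: (H 1%N isT).
have [||ts szts <-] := IH (size w - sumn w)%N.
- by rewrite subnKC.
- by move=> i iw; exact: (H i.+1).
have lx := H 0%N isT; rewrite /= in lx.
exists (Node (take x ts) :: drop x ts) => /=.
  by rewrite size_drop szts; lia.
rewrite size_takel; last by rewrite szts; lia.
by rewrite -flatten_cat -map_cat cat_take_drop.
Qed.

Lemma decode_tree (w : seq nat) : (sumn w).+1 = size w ->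
  (forall i, (i < size w)%N -> (sumn (drop i w) < size (drop i w))%N) ->
  exists t, preorder t = w.
Proof.
rewrite -addn1 => sw H; have [[|t [|]] //= _ <-] := decode_forest sw H.
by exists t; rewrite cats0.
Qed.

(** Starting the word at the first minimum of the walk with steps [x - 1] makes all
   its proper prefixes nonnegative. *)
Lemma cycle_lemma (w : seq nat) : (sumn w).+1 = size w ->
  exists2 i, (i < size w)%N & exists t, preorder t = rot i w.
Proof.
set n := size w => swn.
pose S j := sumn (take j w).
have SE j k : (j <= k)%N -> S k = (S j + sumn (take (k - j) (drop j w)))%N.
  by move=> jk; rewrite /S -sumn_cat -takeD subnKC.
(* The offset of the first minimum of the walk; the lexicographic order of
   (height, position) is encoded in a single number. *)
pose G j := ((S j + (n - j)) * n.+1 + j)%N.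
case: (@arg_minnP 'I_n.+1 ord0 xpredT G isT) => i _ Hi.
have Hmin j : (j <= n)%N -> (S i + (n - i) <= S j + (n - j))%N.
  move=> jn; have jn' : (j < n.+1)%N by [].
  have := Hi (Ordinal jn') isT; rewrite /G /= => le1.
  have := ltn_ord i; nia.
have Hstrict j : (j < i)%N -> (S i + (n - i) < S j + (n - j))%N.
  move=> ji; have jn : (j < n.+1)%N by apply: ltn_trans (ltn_ord i).
  have := Hi (Ordinal jn) isT; rewrite /G /= => le1.
  have := ltn_ord i; nia.
have Sn : (S n).+1 = n by rewrite /S take_size.
have S0 : S 0%N = 0%N by rewrite /S take0.
have i0 : (0 < i)%N.
  by rewrite lt0n; apply/eqP => i0; have := Hmin n (leqnn n); rewrite i0; lia.
have lei : (i <= n)%N by rewrite -ltnS.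
have cond : forall k, (k < n)%N ->
    (sumn (drop k (rot i w)) < size (drop k (rot i w)))%N.
  move=> k kn; rewrite size_drop size_rot -/n /rot drop_cat size_drop -/n.
  have sumdrop j : (j <= n)%N -> (sumn (drop j w) + S j)%N = S n.
    by move=> jn; rewrite addnC /S -sumn_cat cat_take_drop take_size.
  case: (ltnP k (n - i)) => kni.
    rewrite drop_drop sumn_cat -/(S i).
    have := sumdrop (k + i)%N; have := Hmin (k + i)%N; lia.
  have ji : (k - (n - i) < i)%N by lia.
  have := Hstrict _ ji; have := SE _ _ (ltnW ji).
  set j := (k - (n - i))%N in ji *.
  have -> : take (i - j) (drop j w) = drop j (take i w).
    by rewrite -[in RHS](subnK (ltnW ji)) take_drop.
  by lia.
have srot : (sumn (rot i w)).+1 = size (rot i w).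
  by rewrite size_rot /rot sumn_cat addnC -sumn_cat cat_take_drop swn.
have crot k : (k < size (rot i w))%N ->
    (sumn (drop k (rot i w)) < size (drop k (rot i w)))%N.
  by rewrite size_rot; exact: cond.
have [t tE] := decode_tree srot crot.
have [ltin|] := ltnP i n; first by exists i => //; exists t.
move=> ni; have ein : (i : nat) = n by lia.
exists 0%N; first by lia.
by exists t; rewrite tE ein rot_size rot0.
Qed.

Section CycleBound.
Variables (R : realType) (p : nat -> R).
Hypothesis p_ge0 : forall i, 0 <= p i.

(** Each word is a rotation of the code of a tree of the same weight, and a tree
   arises in this way from at most [n] words. *)
Lemma words_le_sized n D :
  \sum_(w <- words (iota 0 D.+1) n | (sumn w).+1 == n) \prod_(x <- w) p x
  <= n%:R * sized p n predT.
Proof.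
pose T := [seq t <- trees n n | tree_size t == n].
have sizedE : sized p n predT = \sum_(t <- T) weight p 1 t.
  by rewrite /sized /mass /T big_filter; apply: eq_bigl => t; rewrite andbT.
have w0 t : 0 <= weight p 1 t by exact: weight_ge0.
rewrite sizedE big_mkcond.
apply: (@le_trans _ _ (\sum_(w <- words (iota 0 D.+1) n)
   \sum_(i < n) \sum_(t <- T) weight p 1 t *+ (preorder t == rot i w))).
  rewrite big_seq [leRHS]big_seq; apply: ler_sum => w.
  rewrite mem_words => /andP[/eqP szw _].
  have rest0 (P : pred 'I_n) : 0 <= \sum_(i < n | P i) \sum_(t <- T)
      weight p 1 t *+ (preorder t == rot i w).
    by apply: sumr_ge0 => i _; apply: sumr_ge0 => t _; rewrite mulrn_wge0.
  case: eqP => [swn|_]; last exact: rest0.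
  have [|i] := @cycle_lemma w; first by rewrite swn szw.
  rewrite szw => ltin [t tE].
  rewrite (bigD1 (Ordinal ltin)) //=.
  apply: le_trans (_ : weight p 1 t + 0 <= _).
    rewrite addr0 weight_preorder tE le_eqVlt; apply/orP; left; apply/eqP.
    by apply/perm_big; rewrite perm_sym perm_rot.
  apply: lerD; last exact: rest0.
  have szt : tree_size t = n by rewrite -size_preorder tE size_rot.
  have tT : t \in T by rewrite mem_filter szt eqxx (trees_of_size szt).
  rewrite (big_rem _ tT) /= tE eqxx mulr1n lerDl.
  by apply: sumr_ge0 => s _; rewrite mulrn_wge0.
rewrite exchange_big /= -[n in n%:R]card_ord -sumr_const mulr_suml.
apply: ler_sum => i _; rewrite exchange_big mul1r; apply: ler_sum => t _ /=.
set W := words _ _.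
have uW : uniq W by apply: uniq_words; exact: (iota_uniq 0 D.+1).
have [/hasP[v vW /eqP tv]|/hasPn no] :=
    boolP (has (fun w => preorder t == rot i w) W).
  rewrite (bigD1_seq v) //= tv eqxx mulr1n big1 ?addr0// => w wv.
  by rewrite (inj_eq (@rot_inj i _)) eq_sym (negbTE wv).
by rewrite big1_seq// => w /andP[_ /no/negbTE->].
Qed.

End CycleBound.

(** * Random words with independent letters *)

Section Words.
Variables (R : realType) (p : nat -> R).
Hypothesis p_ge0 : forall i, 0 <= p i.

Definition rest (d : nat) (w : seq nat) : nat := sumn [seq x <- w | x != d].

Lemma sumn_rest d w : sumn w = (rest d w + d * count_mem d w)%N.
Proof.
elim: w => [|x w IH]; rewrite /rest /= ?muln0// IH /rest.
by case: (eqVneq x d) => [->|_] /=; rewrite ?mulnDr; lia.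
Qed.

(** Changing one letter [0] into a letter [d], or back, is a bijection between
   words with a marked letter. *)
Lemma swap_letters (L : seq nat) (d n : nat) (g : nat -> nat -> nat -> R) :
  uniq L -> 0%N \in L -> d \in L -> (0 < d)%N ->
  p d * (\sum_(w <- words L n) (\prod_(x <- w) p x) * ((count_mem 0%N w)%:R *
     g (rest d w) (count_mem 0%N w).-1 (count_mem d w).+1)) =
  p 0%N * (\sum_(w <- words L n) (\prod_(x <- w) p x) * ((count_mem d w)%:R *
     g (rest d w) (count_mem 0%N w) (count_mem d w))).
Proof.
move=> uL L0 Ld d0; have d0' : (0 == d)%N = false by case: (d) d0.
elim: n g => [|n IH] g; first by rewrite !big_seq1 /= !mul0r !mulr0.
rewrite !big_words_cons.
pose gx x r m l := g (x * (x != d) + r)%N ((x == 0) + m)%N ((x == d) + l)%N.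
pose S := \sum_(w <- words L n) (\prod_(x <- w) p x) *
  g (rest d w) (count_mem 0%N w) (count_mem d w).+1.
have restE x w : rest d (x :: w) = (x * (x != d) + rest d w)%N.
  by rewrite /rest /=; case: eqP => _ /=; rewrite ?muln0 ?muln1.
have EL : \sum_(x <- L) \sum_(w <- words L n) (\prod_(y <- x :: w) p y) *
    ((count_mem 0%N (x :: w))%:R * g (rest d (x :: w))
      (count_mem 0%N (x :: w)).-1 (count_mem d (x :: w)).+1) =
    \sum_(x <- L) p x * (\sum_(w <- words L n) (\prod_(y <- w) p y) *
      ((count_mem 0%N w)%:R * gx x (rest d w) (count_mem 0%N w).-1
        (count_mem d w).+1)) + p 0%N * S.
  rewrite (bigD1_seq 0%N L0 uL) /= [in RHS](bigD1_seq 0%N L0 uL) /=.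
  rewrite addrAC; congr (_ + _); last first.
    apply: eq_bigr => x /negbTE x0; rewrite mulr_sumr; apply: eq_bigr => w _.
    by rewrite big_cons restE /= x0 /gx x0 !add0n addnS -!mulrA.
  rewrite /S !mulr_sumr -big_split; apply: eq_bigr => w _ /=.
  rewrite big_cons restE /= add1n /gx d0' /= ?mul0n !add0n add1n.
  case: (count_mem 0%N w) => [|m] /=; first by ring.
  by rewrite -[m.+2%:R]natr1; ring.
have ER : \sum_(x <- L) \sum_(w <- words L n) (\prod_(y <- x :: w) p y) *
    ((count_mem d (x :: w))%:R * g (rest d (x :: w))
      (count_mem 0%N (x :: w)) (count_mem d (x :: w))) =
    \sum_(x <- L) p x * (\sum_(w <- words L n) (\prod_(y <- w) p y) *
      ((count_mem d w)%:R * gx x (rest d w) (count_mem 0%N w)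
        (count_mem d w))) + p d * S.
  rewrite (bigD1_seq d Ld uL) /= [in RHS](bigD1_seq d Ld uL) /=.
  rewrite addrAC; congr (_ + _); last first.
    apply: eq_bigr => x /negbTE xd; rewrite mulr_sumr; apply: eq_bigr => w _.
    by rewrite big_cons restE /= xd /gx xd !add0n -!mulrA.
  rewrite /S !mulr_sumr -big_split; apply: eq_bigr => w _ /=.
  rewrite big_cons restE /= eqxx add1n /gx eqxx eq_sym d0' /= ?muln0 !add0n add1n.
  by rewrite -[(count_mem d w).+1%:R]natr1; ring.
rewrite EL ER !mulrDr; congr (_ + _); last by rewrite mulrCA.
rewrite !mulr_sumr; apply: eq_bigr => x _.
by rewrite mulrCA IH mulrCA.
Qed.

(** The letters [d] are counted apart from the sum [r] of the others, so that
   exchanging letters 0 and [d] keeps [r] and [m + l]. *)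
Definition cell (D d n r m l : nat) : R :=
  \sum_(w <- words (iota 0 D.+1) n | [&& rest d w == r, count_mem 0%N w == m &
    count_mem d w == l]) \prod_(x <- w) p x.

Lemma cell_ge0 D d n r m l : 0 <= cell D d n r m l.
Proof. by apply: sumr_ge0 => w _; apply: prodr_ge0. Qed.

Lemma cell_swap D d n r m l : (0 < d)%N -> (d <= D)%N ->
  p d * (m.+1%:R * cell D d n r m.+1 l) = p 0%N * (l.+1%:R * cell D d n r m l.+1).
Proof.
move=> d0 dD; set L := iota 0 D.+1.
have uL : uniq L by exact: iota_uniq.
have L0 : 0%N \in L by rewrite mem_iota.
have Ld : d \in L by rewrite mem_iota /= add0n ltnS.
pose g r' m' l' : R := ([&& r' == r, m' == m & l' == l.+1])%:R.
have := swap_letters n g uL L0 Ld d0.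
congr (_ = _); congr (_ * _).
  rewrite /cell mulr_sumr [RHS]big_mkcond; apply: eq_bigr => w _; rewrite /g eqSS.
  case: (count_mem 0%N w) => [|k] /=; first by rewrite mul0r mulr0 andbF.
  rewrite eqSS; case: and3P => [[_ /eqP-> _]|]; first by rewrite mulr1 mulrC.
  by rewrite !mulr0.
rewrite /cell mulr_sumr [RHS]big_mkcond; apply: eq_bigr => w _; rewrite /g.
case: and3P => [[_ _ /eqP->]|_]; first by rewrite mulr1 mulrC.
by rewrite !mulr0.
Qed.

Lemma words_mass (L : seq nat) n :
  \sum_(w <- words L n) \prod_(x <- w) p x = (\sum_(x <- L) p x) ^+ n.
Proof.
rewrite -(big_words_all L n xpredT); apply: eq_bigl => w.
by rewrite all_predT.
Qed.

(** Under truncation the letters keep a small bias [e], whose effect on the second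
   moment is quadratic in [n]. *)
Lemma words_second_moment (L : seq nat) n (f : nat -> R) (V e : R) :
  \sum_(x <- L) p x <= 1 -> \sum_(x <- L) p x * f x ^+ 2 <= V ->
  `|\sum_(x <- L) p x * f x| <= e ->
  \sum_(w <- words L n) (\prod_(x <- w) p x) * (\sum_(x <- w) f x) ^+ 2
    <= n%:R * V + n%:R ^+ 2 * e ^+ 2.
Proof.
move=> p1 pV pe.
set e0 := \sum_(x <- L) p x in p1; set e1 := \sum_(x <- L) p x * f x in pe.
set e2 := \sum_(x <- L) p x * f x ^+ 2 in pV.
have e00 : 0 <= e0 by exact: sumr_ge0.
have e20 : 0 <= e2 by apply: sumr_ge0 => x _; rewrite mulr_ge0 ?sqr_ge0.
have e_ge0 : 0 <= e by apply: le_trans pe.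
pose M k := \sum_(w <- words L k) (\prod_(x <- w) p x) * (\sum_(x <- w) f x).
have MS k : M k.+1 = e1 * e0 ^+ k + e0 * M k.
  rewrite /M big_words_cons -words_mass -/e1 /e1 /e0 !mulr_suml -big_split.
  apply: eq_bigr => x _; rewrite !mulr_sumr -big_split; apply: eq_bigr => w _ /=.
  by rewrite !big_cons; ring.
have Mle k : `|M k| <= k%:R * e.
  elim: k => [|k IH]; first by rewrite /M big_seq1 !big_nil mulr0 normr0 mul0r.
  rewrite MS addrC -natr1 mulrDl mul1r; apply: le_trans (ler_normD _ _) _.
  apply: lerD; rewrite normrM.
    by rewrite ger0_norm//; apply: le_trans IH; rewrite ler_piMl.
  rewrite [X in _ * X]ger0_norm ?exprn_ge0//; apply: le_trans pe.
  by rewrite ler_piMr ?exprn_ile1.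
elim: n => [|n IH].
  by rewrite big_seq1 !big_nil expr0n /= mulr0 !mul0r addr0.
rewrite big_words_cons.
have -> : \sum_(x <- L) \sum_(w <- words L n)
    (\prod_(y <- x :: w) p y) * (\sum_(y <- x :: w) f y) ^+ 2 =
    e2 * e0 ^+ n + 2 * e1 * M n + e0 * (\sum_(w <- words L n)
       (\prod_(x <- w) p x) * (\sum_(x <- w) f x) ^+ 2).
  rewrite /M -words_mass /e1 /e0 /e2 [2 * _]mulr_sumr !mulr_suml -!big_split.
  apply: eq_bigr => x _; rewrite !mulr_sumr -!big_split; apply: eq_bigr => w _ /=.
  by rewrite !big_cons; ring.
set V2 := \sum_(w <- words L n) _ in IH *.
have V20 : 0 <= V2.
  by apply: sumr_ge0 => w _; rewrite mulr_ge0 ?sqr_ge0//; apply: prodr_ge0.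
have h1 : e2 * e0 ^+ n <= V.
  by apply: le_trans pV; rewrite ler_piMr// exprn_ile1.
have h2 : e0 * V2 <= V2 by rewrite ler_piMl.
have h3 : e1 * M n <= e * (n%:R * e).
  by apply: le_trans (ler_norm _) _; rewrite normrM ler_pM.
have h4 : 0 <= e ^+ 2 by exact: sqr_ge0.
rewrite -[n.+1%:R]natr1; lra.
Qed.

Lemma words_markov (L : seq nat) n (F : seq nat -> R) (b : R) (P : pred (seq nat)) : 0 < b ->
  (forall w, ~~ P w -> b <= F w ^+ 2) ->
  \sum_(w <- words L n | ~~ P w) \prod_(x <- w) p x <=
  (\sum_(w <- words L n) (\prod_(x <- w) p x) * F w ^+ 2) / b.
Proof.
move=> b0 PF; rewrite ler_pdivlMr// mulr_suml [leRHS](bigID P) /=.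
apply: ler_wpDl.
  by apply: sumr_ge0 => w _; rewrite mulr_ge0 ?sqr_ge0//; apply: prodr_ge0.
by apply: ler_sum => w /PF bF; apply: ler_wpM2l => //; apply: prodr_ge0.
Qed.

End Words.

(** * A polynomial lower bound for the size distribution *)

Lemma expR_sub_le (R : realType) (x : R) : 0 <= x <= 1 / 2 ->
  expR (- (2 * x)) <= 1 - x.
Proof.
move=> x0; have x1 : 0 < 1 - x by lra.
rewrite expRN -[leRHS]invrK lef_pV2 ?posrE ?expR_gt0 ?invr_gt0//.
apply: le_trans (expR_ge1Dx _); rewrite -[leLHS]mul1r ler_pdivrMr//.
have h : 0 <= x * (1 - 2 * x) by rewrite mulr_ge0; lra.
by lra.
Qed.

(** A sequence whose ratios are those of a binomial distribution changes by at
   most a constant factor over a distance of order [sqrt n] around its mode. *)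
Lemma binomial_shift (R : realType) (a b beta eps : R) :
  0 < a <= 1 -> 0 < b <= 1 -> 0 <= beta -> 0 <= eps ->
  exists2 c, 0 < c & exists N, forall n, (N <= n)%N -> forall (M L q : nat),
    `|M%:R - b * n%:R| <= beta * Num.sqrt n%:R ->
    `|L%:R - a * n%:R| <= beta * Num.sqrt n%:R ->
    q%:R <= eps * Num.sqrt n%:R ->
    (q <= M)%N /\ forall u : nat -> R, (forall i, 0 <= u i) ->
      (forall i, (i < q)%N -> a * ((M - i)%:R * u i) = b * ((L + i).+1%:R * u i.+1)) ->
      c * u 0%N <= u q.
Proof.
move=> a01 b01 beta0 eps0.
pose E := 2 * (beta + eps) + 1.
have ab0 : 0 < a * b by rewrite mulr_gt0; lra.
exists (expR (- (4 * E * eps / (a * b)))); first exact: expR_gt0.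
(* Beyond the threshold [s0] for [sqrt n], the relative drift [x] of the ratios is
   at most 1 / 2 and [q] is at most [M]. *)
pose s0 := 1 + 2 * beta / a + 4 * E / (a * b) + (beta + eps) / b.
have t1 : 0 <= 2 * beta / a by rewrite divr_ge0; lra.
have t2 : 0 <= 4 * E / (a * b) by rewrite divr_ge0 ?mulr_ge0 /E; lra.
have t3 : 0 <= (beta + eps) / b by rewrite divr_ge0; lra.
exists (Num.bound (s0 ^+ 2)) => n Nn M L q.
have s0n : s0 <= Num.sqrt n%:R.
  have s00 : 0 <= s0 by rewrite /s0; lra.
  rewrite -(ger0_norm s00) -sqrtr_sqr; apply: ler_wsqrtr.
  have := archi_boundP (sqr_ge0 s0) => /ltW/le_trans; apply.
  by rewrite ler_nat.
have nE : n%:R = Num.sqrt n%:R ^+ 2 :> R by rewrite sqr_sqrtr.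
move: (Num.sqrt _) nE s0n => s -> s0s.
have s1 : 1 <= s by rewrite /s0 in s0s; lra.
have s_beta : 2 * beta <= s * a by rewrite -ler_pdivrMr; rewrite /s0 in s0s; lra.
have s_E : 4 * E <= s * (a * b) by rewrite -ler_pdivrMr//; rewrite /s0 in s0s; lra.
have s_q : beta + eps <= s * b by rewrite -ler_pdivrMr; rewrite /s0 in s0s; lra.
rewrite !ler_norml => hM hL hq.
have qM : q%:R <= M%:R :> R.
  have h : s * (beta + eps) <= s * (s * b) by apply: ler_wpM2l => //; lra.
  by lra.
split; first by rewrite -(ler_nat R).
move=> u u0 Hu.
pose x := 2 * E / (a * b * s).
have abs0 : 0 < a * b * s by rewrite mulr_gt0//; lra.
have xE : x * (a * b * s) = 2 * E by rewrite /x divfK// gt_eqF.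
have x01 : 0 <= x <= 1 / 2.
  rewrite /x divr_ge0 ?(ltW abs0)//=; last by rewrite /E; lra.
  by rewrite ler_pdivrMr//; lra.
have step i : (i < q)%N -> (1 - x) * u i <= u i.+1.
  move=> iq; have Li : 0 < b * (L + i).+1%:R by rewrite mulr_gt0 ?ltr0n//; lra.
  rewrite -(ler_pM2l Li) -[leRHS]mulrA -(Hu i iq) !mulrA; apply: ler_wpM2r => //.
  have iq' : i%:R + 1 <= q%:R :> R by rewrite natr1 ler_nat.
  have i0 : 0 <= i%:R :> R by [].
  rewrite natrB; last by rewrite -(ler_nat R); lra.
  rewrite -natr1 natrD.
  have h1 : a * (b * s ^+ 2 - (beta + eps) * s) <= a * (M%:R - i%:R).
    by apply: ler_wpM2l; lra.
  have h2 : b * (L%:R + i%:R + 1) <= b * (a * s ^+ 2 + (beta + eps) * s + 1).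
    by apply: ler_wpM2l; lra.
  have h3 : (a + b) * ((beta + eps) * s) <= 2 * ((beta + eps) * s).
    by apply: ler_wpM2r; [rewrite mulr_ge0; lra | lra].
  have h4 : s * (2 * beta) <= s * (s * a) by apply: ler_wpM2l => //; lra.
  have h5 : b * (a * s ^+ 2 / 2) <= b * (L%:R + i%:R + 1).
    by apply: ler_wpM2l; lra.
  have h6 : x * (b * (a * s ^+ 2 / 2)) <= x * (b * (L%:R + i%:R + 1)).
    by apply: ler_wpM2l => //; lra.
  have h7 : x * (b * (a * s ^+ 2 / 2)) = E * s.
    have -> : x * (b * (a * s ^+ 2 / 2)) = x * (a * b * s) * s / 2 by ring.
    by rewrite xE; field.
  rewrite h7 in h6.
  have h8 : E * s = 2 * ((beta + eps) * s) + s by rewrite /E; ring.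
  have -> : b * (L%:R + i%:R + 1) * (1 - x) =
    b * (L%:R + i%:R + 1) - x * (b * (L%:R + i%:R + 1)) by ring.
  by lra.
have pow i : (i <= q)%N -> (1 - x) ^+ i * u 0%N <= u i.
  elim: i => [_|i IH iq]; first by rewrite expr0 mul1r.
  rewrite exprS -mulrA; apply: le_trans (step i iq).
  by apply: ler_wpM2l; [lra | apply: IH; exact: ltnW].
apply: le_trans (pow q (leqnn q)); apply: ler_wpM2r => //.
apply: (@le_trans _ _ (expR (- (2 * x)) ^+ q)); last first.
  apply: lerXn2r; rewrite ?nnegrE ?expR_ge0//; first by lra.
  exact: expR_sub_le.
rewrite -expRM_natl ler_expR mulrN lerN2.
have -> : 4 * E * eps / (a * b) = 2 * x * (eps * s).
  rewrite /x; field; rewrite !gt_eqF//; lra.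
by rewrite mulrC; apply: ler_wpM2l => //; lra.
Qed.

Lemma sum_gt0_ex (R : realDomainType) (I : eqType) (s : seq I) (P : pred I)
    (F : I -> R) :
  0 < \sum_(i <- s | P i) F i -> exists2 i, i \in s & P i /\ 0 < F i.
Proof.
move=> S0; apply: contrapT => no; move: S0; rewrite ltNge => /negP; apply.
rewrite big_seq_cond; apply: sumr_le0 => i /andP[si Pi].
by rewrite leNgt; apply/negP => Fi; apply: no; exists i.
Qed.

Lemma prod_gt0_all (R : realDomainType) (p : nat -> R) (w : seq nat) :
  (forall i, 0 <= p i) -> 0 < \prod_(x <- w) p x ->
  forall x, x \in w -> 0 < p x.
Proof.
move=> p0; elim: w => [|y w IH]//; rewrite big_cons => pyw x.
have w0 : 0 <= \prod_(x <- w) p x by exact: prodr_ge0.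
have y0 : 0 < p y.
  by rewrite lt_neqAle p0 andbT eq_sym; apply: contraTneq pyw => ->; rewrite mul0r ltxx.
rewrite in_cons => /predU1P[->//|]; apply: IH.
by move: pyw; rewrite pmulr_rgt0.
Qed.

Lemma words_cat (R : nmodType) (T : Type) (L : seq T) a b (F : seq T -> R) :
  \sum_(w <- words L (a + b)) F w =
  \sum_(u <- words L a) \sum_(v <- words L b) F (u ++ v).
Proof.
elim: a F => [|a IH] F; first by rewrite add0n big_seq1.
by rewrite addSn !big_words_cons; apply: eq_bigr => x _; rewrite IH.
Qed.

Section GoodCells.
Variables (R : realType) (p : nat -> R) (s2 : R) (d : nat).
Hypothesis hp : critical_law p s2.
Hypothesis hd : min_branching p d.
Let p_ge0 := law_ge0 hp.

Lemma sum_iota D (F : nat -> R) :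
  \sum_(x <- iota 0 D.+1) F x = \sum_(i < D.+1) F i.
Proof. by rewrite -(big_mkord xpredT) /index_iota subn0. Qed.

Lemma law_sum_le1 D : \sum_(x <- iota 0 D.+1) p x <= 1.
Proof.
rewrite sum_iota; have := pgf_le1 hp D.+1 (x := 1).
rewrite ler01 lexx => /(_ isT); under eq_bigr do rewrite expr1n mulr1.
by [].
Qed.

(** Otherwise the offspring number minus 1 is nonnegative with mean 0. *)
Lemma leaf_gt0 : 0 < p 0%N.
Proof.
have d1 := branch_gt1 hd; have pd := branch_gt0 hd.
rewrite lt_neqAle p_ge0 andbT; apply/negP => /eqP p00.
have cv : \sum_(i < n) p i * i%:R - \sum_(i < n) p i @[n --> \oo] --> (1 - 1 : R).
  by apply: cvgB; [exact: (law_mean hp) | exact: (law_mass hp)].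
suff : p d <= 1 - 1 by rewrite subrr leNgt pd.
apply: (cvgr_to_ge cv); exists d.+1 => // n /= dn.
rewrite -sumrB (bigD1 (Ordinal dn)) //=.
have nn i : 0 <= p i * i%:R - p i.
  case: i => [|i]; first by rewrite -p00 mul0r subrr.
  by rewrite -natr1 mulrDr mulr1 addrK mulr_ge0.
rewrite -[leLHS]addr0; apply: lerD; last by apply: sumr_ge0.
rewrite -[X in _ <= _ - X]mulr1 -mulrBr ler_peMr// lerBrDr.
by rewrite (_ : 1 + 1 = 2%:R) ?ler_nat.
Qed.

Lemma sum_centered (c : nat) D : (c <= D)%N ->
  \sum_(x <- iota 0 D.+1) p x * ((x == c)%:R - p c) =
  p c * (1 - \sum_(i < D.+1) p i).
Proof.
move=> cD; rewrite sum_iota; under eq_bigr do rewrite mulrBr.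
rewrite sumrB -mulr_suml mulrBr mulr1 [p c * _]mulrC; congr (_ - _).
have cD' : (c < D.+1)%N by [].
rewrite (bigD1 (Ordinal cD')) //= eqxx mulr1 big1 ?addr0// => i.
by rewrite -val_eqE /= => /negbTE->; rewrite mulr0.
Qed.

Lemma sum_letter_indic (c : nat) (a : R) (w : seq nat) :
  \sum_(x <- w) ((x == c)%:R - a) = (count_mem c w)%:R - a * (size w)%:R.
Proof.
elim: w => [|x w IH]; first by rewrite big_nil mulr0 subr0.
by rewrite big_cons IH /= natrD -natr1; ring.
Qed.

Lemma sum_letter (w : seq nat) :
  \sum_(x <- w) (x%:R - 1) = (sumn w)%:R - (size w)%:R :> R.
Proof.
elim: w => [|x w IH]; first by rewrite big_nil subr0.
by rewrite big_cons IH /= natrD -natr1; ring.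
Qed.

(* The constant 12 makes each of the three Chebyshev bounds at most 1 / 12, so
   that atypical words have mass at most 1 / 4. *)
Let V := s2 + 1.
Let B := 12 * (V + 1).

Lemma V_ge1 : 1 <= V.
Proof. by rewrite /V lerDr ltW// (variance_gt0 hp hd). Qed.

Definition typical n (w : seq nat) : bool :=
  [&& ((sumn w)%:R - n%:R) ^+ 2 <= B * n%:R,
      ((count_mem 0%N w)%:R - p 0%N * n%:R) ^+ 2 <= B * n%:R &
      ((count_mem d w)%:R - p d * n%:R) ^+ 2 <= B * n%:R].

(** The alphabet is enlarged with [n] until the total mass of the words and the
   means of the statistics are close enough to those of the full law. *)
Lemma typical_mass n : (0 < n)%N -> exists D0, forall D, (D0 <= D)%N ->
  1 / 2 <= \sum_(w <- words (iota 0 D.+1) n | typical n w) \prod_(x <- w) p x.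
Proof.
move=> n0; have n1 : 1 <= n%:R :> R by rewrite ler1n.
have V1 := V_ge1.
pose eta : R := (4 * n%:R)^-1.
have eta0 : 0 < eta by rewrite invr_gt0; lra.
have neta : n%:R * eta = 1 / 4 by rewrite /eta; field; rewrite gt_eqF//; lra.
have eta1 : eta <= 1 / 4 by rewrite -neta ler_peMl// ltW.
have [N1 _ H1] := cvgr_distC_le _ _ (law_mass hp) _ eta0.
have cv : \sum_(i < n) p i * i%:R - \sum_(i < n) p i @[n --> \oo] --> (1 - 1 : R).
  by apply: cvgB; [exact: (law_mean hp) | exact: (law_mass hp)].
have [N2 _ H2] := cvgr_distC_le _ _ cv _ eta0.
exists (N1 + N2 + d)%N => D hD; set L := iota 0 D.+1.
have dD : (d <= D)%N by lia.
have S0 : 1 - eta <= \sum_(i < D.+1) p i.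
  by have := H1 D.+1 ltac:(by rewrite /=; lia); rewrite /= ler_norml; lra.
have S1 : `|\sum_(i < D.+1) p i * i%:R - \sum_(i < D.+1) p i| <= eta.
  by have := H2 D.+1 ltac:(by rewrite /=; lia); rewrite /= subrr subr0.
have L1 := law_sum_le1 D.
have cheb (f : nat -> R) : \sum_(x <- L) p x * f x ^+ 2 <= V ->
    `|\sum_(x <- L) p x * f x| <= eta ->
    \sum_(w <- words L n | ~~ ((\sum_(x <- w) f x) ^+ 2 <= B * n%:R))
      \prod_(x <- w) p x <= 1 / 12.
  move=> fV fe; have Bn : 0 < B * n%:R by rewrite mulr_gt0 /B; lra.
  apply: le_trans (words_markov p_ge0 (F := fun w => \sum_(x <- w) f x) L n Bn _) _.
    by move=> w; rewrite -ltNge => /ltW.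
  rewrite ler_pdivrMr//; apply: le_trans (words_second_moment p_ge0 n L1 fV fe) _.
  have -> : n%:R ^+ 2 * eta ^+ 2 = (n%:R * eta) ^+ 2 by rewrite exprMn.
  by rewrite neta /B; lra.
have c1 : \sum_(w <- words L n | ~~ (((sumn w)%:R - n%:R) ^+ 2 <= B * n%:R))
      \prod_(x <- w) p x <= 1 / 12.
  have F1 : \sum_(x <- L) p x * (x%:R - 1) ^+ 2 <= V.
    rewrite sum_iota; apply: (@le_trans _ _ (\sum_(i < D.+1) p i *
      (i%:R * (i%:R - 1)) + \sum_(i < D.+1) p i)).
      rewrite -big_split; apply: ler_sum => i _ /=.
      rewrite -[X in _ <= _ + X]mulr1 -mulrDr; apply: ler_wpM2l => //.
      have i0 : 0 <= i%:R :> R by [].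
      by lra.
    by apply: lerD; [exact: (variance_ge hp) | rewrite -sum_iota].
  have F2 : `|\sum_(x <- L) p x * (x%:R - 1)| <= eta.
    rewrite sum_iota; under eq_bigr do rewrite mulrBr mulr1.
    by rewrite sumrB.
  have H := cheb _ F1 F2.
  apply: le_trans H; rewrite le_eqVlt; apply/orP; left; apply/eqP.
  rewrite big_seq_cond [RHS]big_seq_cond; apply: eq_bigl => w.
  apply: andb_id2l; rewrite mem_words => /andP[/eqP szw _].
  by rewrite sum_letter szw.
have c2 c : (c <= D)%N -> \sum_(w <- words L n | ~~
      (((count_mem c w)%:R - p c * n%:R) ^+ 2 <= B * n%:R))
      \prod_(x <- w) p x <= 1 / 12.
  move=> cD; have pc1 := law_le1 hp c; have pc0 := p_ge0 c.
  have F1 : \sum_(x <- L) p x * ((x == c)%:R - p c) ^+ 2 <= V.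
    apply: le_trans V1; apply: le_trans L1; apply: ler_sum => x _.
    by rewrite ler_piMr//; case: (x == c) => /=; rewrite expr2; nra.
  have F2 : `|\sum_(x <- L) p x * ((x == c)%:R - p c)| <= eta.
    have q0 : 0 <= 1 - \sum_(i < D.+1) p i by rewrite subr_ge0 -sum_iota.
    rewrite sum_centered// normrM !ger0_norm//.
    have q1 : 1 - \sum_(i < D.+1) p i <= eta by lra.
    by apply: le_trans q1; rewrite ler_piMl.
  have H := cheb _ F1 F2.
  apply: le_trans H; rewrite le_eqVlt; apply/orP; left; apply/eqP.
  rewrite big_seq_cond [RHS]big_seq_cond; apply: eq_bigl => w.
  apply: andb_id2l; rewrite mem_words => /andP[/eqP szw _].
  by rewrite sum_letter_indic szw.
have c0 := c2 0%N (leq0n _); have cd := c2 d dD.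
have tot : 3 / 4 <= \sum_(w <- words L n) \prod_(x <- w) p x.
  rewrite words_mass sum_iota; apply: (@le_trans _ _ ((1 - eta) ^+ n)).
    apply: le_trans (expr_taylor1 n _); first by lra.
    by lra.
  apply: lerXn2r; rewrite ?nnegrE//; last exact: sumr_ge0.
  by lra.
rewrite (bigID (typical n)) /= in tot.
suff : \sum_(w <- words L n | ~~ typical n w) \prod_(x <- w) p x <= 3 / 12 by lra.
apply: (@le_trans _ _ (1 / 12 + 1 / 12 + 1 / 12)); last by lra.
apply: le_trans (lerD (lerD c1 c0) cd).
rewrite big_mkcond [X in _ <= X + _ + _]big_mkcond [X in _ <= _ + X + _]big_mkcond.
rewrite [X in _ <= _ + _ + X]big_mkcond -!big_split; apply: ler_sum => w _ /=.
have w0 : 0 <= \prod_(x <- w) p x by exact: prodr_ge0.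
rewrite /typical; case: (((sumn w)%:R - n%:R) ^+ 2 <= B * n%:R);
case: (((count_mem 0%N w)%:R - p 0%N * n%:R) ^+ 2 <= B * n%:R);
by case: (((count_mem d w)%:R - p d * n%:R) ^+ 2 <= B * n%:R) => /=; lra.
Qed.

(** Typical words fill at most [(N1 * n) ^ 3] cells, so one of these carries a
   mass of order at least [n ^ (- 3)]. *)
Lemma typical_cell : exists2 c, 0 < c & exists2 beta, 0 <= beta &
  forall n, (0 < n)%N -> exists D0, forall D, (D0 <= D)%N -> exists r m l,
    [/\ `|(r + d * l)%:R - n%:R| <= beta * Num.sqrt n%:R,
        `|m%:R - p 0%N * n%:R| <= beta * Num.sqrt n%:R,
        `|l%:R - p d * n%:R| <= beta * Num.sqrt n%:R &
        c / n%:R ^+ 3 <= cell p D d n r m l].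
Proof.
have V1 := V_ge1; have B0 : 0 < B by rewrite /B; lra.
pose N1 := (Num.bound B + 3)%N.
have N1B : B + 3 <= N1%:R.
  by rewrite /N1 natrD lerD2r; apply/ltW/archi_boundP/ltW.
have N10 : 0 < N1%:R :> R by lra.
exists ((4 * N1%:R ^+ 3)^-1); first by rewrite invr_gt0 mulr_gt0 ?exprn_gt0.
exists (Num.sqrt B) => // n n0; have [D0 HD0] := typical_mass n0.
exists D0 => D /HD0; set L := iota 0 D.+1 => Htyp.
have n0' : 0 < n%:R :> R by rewrite ltr0n.
have n1 : 1 <= n%:R :> R by rewrite ler1n.
apply: contrapT => no.
pose Q := (N1 * n).-1.
have QE : Q.+1 = (N1 * n)%N by rewrite prednK// muln_gt0 n0 andbT -(ltr0n R).
have typ_lt w : w \in words L n -> typical n w ->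
    [/\ (rest d w < Q.+1)%N, (count_mem 0%N w < Q.+1)%N & (count_mem d w < Q.+1)%N].
  rewrite mem_words => /andP[/eqP szw _] /and3P[t1 _ _].
  have cnt c : (count_mem c w < Q.+1)%N.
    rewrite QE; apply: (@leq_ltn_trans n); first by rewrite -szw count_size.
    by rewrite -(ltr_nat R) natrM; nra.
  split=> //; rewrite QE; apply: (@leq_ltn_trans (sumn w)).
    by rewrite (sumn_rest d) leq_addr.
  rewrite -(ltr_nat R) natrM.
  have t2 : ((sumn w)%:R - n%:R) ^+ 2 <= ((B + 1) * n%:R) ^+ 2.
    apply: le_trans t1 _; rewrite exprMn.
    have h1 : B <= (B + 1) ^+ 2 by rewrite sqrrD; nra.
    have h2 : n%:R <= n%:R ^+ 2 :> R by rewrite expr2 ler_peMr// ltW.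
    by apply: ler_pM => //; lra.
  have : `|(sumn w)%:R - n%:R| <= (B + 1) * n%:R.
    by rewrite -ler_sqr ?nnegrE ?mulr_ge0 ?real_normK ?num_real//; lra.
  rewrite ler_norml => /andP[_ t3]; nra.
pose delta : R := (4 * N1%:R ^+ 3)^-1 / n%:R ^+ 3.
have delta0 : 0 <= delta.
  by rewrite divr_ge0 ?exprn_ge0// invr_ge0 mulr_ge0 ?exprn_ge0.
have sq (x : R) : x ^+ 2 <= B * n%:R -> `|x| <= Num.sqrt B * Num.sqrt n%:R.
  by move=> xB; rewrite -sqrtrM ?(ltW B0)// -sqrtr_sqr ler_wsqrtr.
pose st w : 'I_Q.+1 * 'I_Q.+1 * 'I_Q.+1 :=
  (inord (rest d w), inord (count_mem 0%N w), inord (count_mem d w)).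
rewrite big_seq_cond (partition_big st xpredT) //= in Htyp.
have inner (j : 'I_Q.+1 * 'I_Q.+1 * 'I_Q.+1) :
    \sum_(w <- words L n | ((w \in words L n) && typical n w) && (st w == j))
      \prod_(x <- w) p x <= delta.
  case: j => [[r m] l].
  have stE w : w \in words L n -> typical n w -> st w == (r, m, l) ->
      [/\ rest d w = r, count_mem 0%N w = m & count_mem d w = l].
    move=> wW tw; have [h1 h2 h3] := typ_lt w wW tw.
    by rewrite /st !xpair_eqE => /andP[/andP[/eqP<- /eqP<-] /eqP<-]; rewrite !inordK.
  have [[w [wW tw sw]]|none] := pselect (exists w,
      [/\ w \in words L n, typical n w & st w == (r, m, l)]); last first.
    rewrite big1// => w /andP[/andP[wW tw] sw].
    by exfalso; apply: none; exists w.
  have [e1 e2 e3] := stE w wW tw sw.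
  apply: (@le_trans _ _ (cell p D d n r m l)).
    rewrite /cell big_mkcond [leRHS]big_mkcond; apply: ler_sum => v _.
    have v0 : 0 <= \prod_(x <- v) p x by exact: prodr_ge0.
    case: ifP => [/andP[/andP[vW tv] sv]|_]; last by case: ifP.
    by have [-> -> ->] := stE v vW tv sv; rewrite !eqxx.
  rewrite leNgt; apply/negP => dc; apply: no; exists r, m, l.
  have /and3P[t1 t2 t3] := tw.
  split; [|by rewrite -e2; exact: sq|by rewrite -e3; exact: sq|exact: ltW].
  by rewrite -e1 -e3 -sumn_rest; exact: sq.
have : \sum_(j : 'I_Q.+1 * 'I_Q.+1 * 'I_Q.+1) delta = 1 / 4.
  rewrite sumr_const !card_prod card_ord QE -[LHS]mulr_natl /delta !natrM.
  by field; rewrite !gt_eqF.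
move=> dsum; have := le_trans Htyp (ler_sum _ (fun j _ => inner j)).
by rewrite dsum; lra.
Qed.

End GoodCells.

Section SizeLowerBound.
Variables (R : realType) (p : nat -> R) (s2 : R) (d : nat).
Hypothesis hp : critical_law p s2.
Hypothesis hd : min_branching p d.
Let p_ge0 := law_ge0 hp.

(** Words of one common length that realize, with a common positive lower
   bound on their probability, every residue modulo [d] that sums of
   offspring numbers can take. *)
Lemma residue_words : exists L0 b c, 0 < c /\
  forall s : seq nat, (forall x, x \in s -> 0 < p x) ->
  exists v, [/\ size v = L0, (sumn v <= b)%N, sumn v = sumn s %[mod d] &
    c <= \prod_(x <- v) p x].
Proof.
have d0 : (0 < d)%N by apply: ltnW; exact: (branch_gt1 hd).
have p00 := leaf_gt0 hp hd.
suff H N : exists L0 b c, 0 < c /\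
    forall s : seq nat, (forall x, x \in s -> 0 < p x) -> (sumn s %% d < N)%N ->
    exists v, [/\ size v = L0, (sumn v <= b)%N, sumn v = sumn s %[mod d] &
    c <= \prod_(x <- v) p x].
  have [L0 [b [c [c0 Hc]]]] := H d; exists L0, b, c; split=> // s Hs.
  by apply: Hc => //; rewrite ltn_mod.
elim: N => [|N [L0 [b [c [c0 Hc]]]]]; first by exists 0%N, 0%N, 1; split.
have [[s1 [Hs1 s1N]]|none] := pselect (exists s1 : seq nat,
    (forall x, x \in s1 -> 0 < p x) /\ (sumn s1 %% d = N)%N); last first.
  exists L0, b, c; split=> // s Hs; rewrite ltnS leq_eqVlt => /predU1P[sN|]; last exact: Hc.
  by exfalso; apply: none; exists s.
(* Padding by zeros keeps the sum and makes the lengths agree. *)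
pose c1 := \prod_(x <- s1) p x.
have c10 : 0 < c1 by rewrite /c1 big_seq; apply: prodr_gt0.
have pad k v : \prod_(x <- v ++ nseq k 0%N) p x = \prod_(x <- v) p x * p 0%N ^+ k.
  by rewrite big_cat big_nseq iter_mulr_1.
have sumpad k v : sumn (v ++ nseq k 0%N) = sumn v.
  by rewrite sumn_cat sumn_nseq mul0n addn0.
exists (L0 + size s1)%N, (b + sumn s1)%N.
exists (Num.min (c * p 0%N ^+ size s1) (c1 * p 0%N ^+ L0)); split.
  by rewrite lt_min !mulr_gt0 ?exprn_gt0.
move=> s Hs; rewrite ltnS leq_eqVlt => /predU1P[sN|sN].
  exists (s1 ++ nseq L0 0%N); split.
  - by rewrite size_cat size_nseq addnC.
  - by rewrite sumpad leq_addl.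
  - by rewrite sumpad s1N sN.
  - by rewrite pad ge_min lexx orbT.
have [v [szv vb vs cv]] := Hc s Hs sN.
exists (v ++ nseq (size s1) 0%N); split.
- by rewrite size_cat size_nseq szv.
- by rewrite sumpad (leq_trans vb) ?leq_addr.
- by rewrite sumpad.
- rewrite pad ge_min; apply/orP; left.
  by apply: ler_wpM2r => //; rewrite exprn_ge0.
Qed.

(** The exponent is not optimal; only its finiteness matters below, since all
   competing probabilities decay faster than any power. *)
Lemma sized_ge : exists2 c, 0 < c & exists N, forall n, (N <= n)%N ->
  0 < sized p n predT -> c / n%:R ^+ 4 <= sized p n predT.
Proof.
have d1 := branch_gt1 hd; have d0 : (0 < d)%N by exact: ltnW.
have p00 := leaf_gt0 hp hd; have pd0 := branch_gt0 hd.
have [L0 [b [c1 [c10 Hres]]]] := residue_words.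
have [c2 c20 [beta beta0 Hcell]] := typical_cell hp hd.
pose eps := beta + (L0 + b + 1)%:R.
have eps0 : 0 <= eps by rewrite /eps addr_ge0.
have p01 : 0 < p 0%N <= 1 by rewrite p00 (law_le1 hp).
have pd1 : 0 < p d <= 1 by rewrite pd0 (law_le1 hp).
have [cf cf0 [Nf Hf]] := binomial_shift pd1 p01 beta0 eps0.
have [cb cb0 [Nb Hb]] := binomial_shift p01 pd1 beta0 eps0.
pose c3 := Num.min cf cb.
have c30 : 0 < c3 by rewrite lt_min cf0.
exists (c1 * c2 * c3); first by rewrite !mulr_gt0.
exists (L0 + Nf + Nb + 1)%N => n Nn an0.
pose n' := (n - L0)%N.
have n'n : n = (n' + L0)%N by clear -Nn; lia.
have n'0 : (0 < n')%N by clear -Nn; lia.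
have Nfn : (Nf <= n')%N by clear -Nn; lia.
have Nbn : (Nb <= n')%N by clear -Nn; lia.
have n0 : (0 < n)%N by clear -Nn; lia.
have [D0 HD0] := Hcell n' n'0.
pose D := (D0 + d + b)%N.
have [r [m [l [hsum hm hl hcell]]]] := HD0 D ltac:(by rewrite /D -addnA leq_addr).
set L := iota 0 D.+1.
have n'0' : 0 < n'%:R :> R by rewrite ltr0n.
have cell0 : 0 < cell p D d n' r m l.
  by apply: lt_le_trans hcell; rewrite divr_gt0 ?exprn_gt0.
have s1 : 1 <= Num.sqrt n'%:R :> R by rewrite -[leLHS]sqrtr1 ler_wsqrtr ?ler1n.
(* One word of positive probability in the chosen cell, and one for the
   preorder code of a tree of size n, certify the residue to be corrected. *)
have [w0 _ [/and3P[/eqP w0r _ /eqP w0l] w0p]] := sum_gt0_ex cell0.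
have [t _ [/andP[/eqP szt _] tp]] := sum_gt0_ex an0.
rewrite weight_preorder in tp.
have sw0 : sumn w0 = (r + d * l)%N by rewrite (sumn_rest d) w0r w0l.
have st : (sumn (preorder t)).+1 = n by rewrite sumn_preorder.
pose k := (r + d * l)%N.
pose s := preorder t ++ flatten (nseq d.-1 w0).
have ss : sumn s = (n.-1 + d.-1 * k)%N.
  rewrite /s sumn_cat sumn_flatten map_nseq sumn_nseq sw0 mulnC -/k.
  by congr (_ + _)%N; rewrite -st.
have [|v [szv vb vs cv]] := Hres s.
  move=> x; rewrite mem_cat => /orP[|/flattenP[w]]; first exact: (prod_gt0_all p_ge0 tp).
  by rewrite mem_nseq => /andP[_ /eqP->]; exact: (prod_gt0_all p_ge0 w0p).
have cong : (sumn v + k = n.-1 %[mod d])%N.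
  rewrite -modnDml vs ss modnDml -addnA.
  have -> : (d.-1 * k + k = k * d)%N by rewrite -mulSnr prednK// mulnC.
  by rewrite addnC modnMDl.
have n'k : `|k%:R - n'%:R| <= beta * Num.sqrt n'%:R by [].
(* The number of letters to exchange. *)
have qbound (q : nat) (e : R) : d%:R * q%:R = `|e| ->
    `|e - (k%:R - n'%:R)| <= (L0 + b + 1)%:R \/
    `|e + (k%:R - n'%:R)| <= (L0 + b + 1)%:R -> q%:R <= eps * Num.sqrt n'%:R.
  move=> qe he; have q1 : q%:R <= `|e|.
    by rewrite -qe ler_peMl ?ler1n.
  have c0 : 0 <= (L0 + b + 1)%:R :> R by [].
  have h1 : (L0 + b + 1)%:R <= (L0 + b + 1)%:R * Num.sqrt n'%:R :> R.
    by rewrite ler_peMr.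
  have h2 : `|e| <= `|k%:R - n'%:R| + (L0 + b + 1)%:R.
    case: he => he; first have -> : e = (e - (k%:R - n'%:R)) + (k%:R - n'%:R) by ring.
      by apply: le_trans (ler_normD _ _) _; lra.
    have -> : e = (e + (k%:R - n'%:R)) - (k%:R - n'%:R) by ring.
    by apply: le_trans (ler_normB _ _) _; lra.
  rewrite /eps mulrDl; lra.
have target m' l' : (sumn v + (r + d * l') = n.-1)%N ->
    c3 * cell p D d n' r m l <= cell p D d n' r m' l' ->
    c1 * c2 * c3 / n%:R ^+ 4 <= sized p n predT.
  move=> hsumv hle.
  have n1 : 1 <= n%:R :> R by rewrite ler1n.
  have bound : c1 * cell p D d n' r m' l' <= n%:R * sized p n predT.
    apply: le_trans (words_le_sized p_ge0 n D).
    rewrite {1}n'n -/L big_mkcond words_cat mulrC /cell mulr_suml big_mkcond.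
    apply: ler_sum => u _.
    have F0 (w : seq nat) : 0 <= (if (sumn w).+1 == n then \prod_(x <- w) p x else 0).
      by case: ifP => // _; exact: prodr_ge0.
    case: and3P => [[/eqP ur _ /eqP ul]|_]; last exact: sumr_ge0.
    have vL : v \in words L L0.
      rewrite mem_words szv eqxx; apply/allP => x /mem_sumn xv.
      rewrite [mem L x]mem_iota /= add0n ltnS (leq_trans xv)// (leq_trans vb)// /D.
      by rewrite leq_addl.
    rewrite (big_rem _ vL) /= -[leLHS]addr0; apply: lerD; last exact: sumr_ge0.
    rewrite sumn_cat (sumn_rest d u) ur ul.
    have -> : (r + d * l' + sumn v).+1 = n by rewrite addnC hsumv prednK.
    rewrite eqxx big_cat /=; apply: ler_wpM2l => //; exact: prodr_ge0.
  have h1 : c1 * (c3 * (c2 / n'%:R ^+ 3)) <= n%:R * sized p n predT.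
    apply: le_trans bound; apply: ler_wpM2l; first exact: ltW.
    by apply: le_trans hle; apply: ler_wpM2l => //; exact: ltW.
  rewrite ler_pdivrMr ?exprn_gt0//; last by lra.
  have n3 : n'%:R ^+ 3 <= n%:R ^+ 3 :> R.
    by apply: lerXn2r; rewrite ?nnegrE//; rewrite ler_nat n'n leq_addr.
  have n'3 : 0 < n'%:R ^+ 3 :> R by rewrite exprn_gt0.
  have h2 : c1 * c2 * c3 = c1 * (c3 * (c2 / n'%:R ^+ 3)) * n'%:R ^+ 3.
    by field; rewrite gt_eqF.
  rewrite h2; apply: (@le_trans _ _ (n%:R * sized p n predT * n%:R ^+ 3)); last first.
    by rewrite le_eqVlt; apply/orP; left; apply/eqP; ring.
  apply: ler_pM => //.
  by apply/ltW; rewrite !mulr_gt0// invr_gt0.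
have c3f : c3 * cell p D d n' r m l <= cf * cell p D d n' r m l.
  by apply: ler_wpM2r; [exact: ltW | rewrite ge_min lexx].
have c3b : c3 * cell p D d n' r m l <= cb * cell p D d n' r m l.
  by apply: ler_wpM2r; [exact: ltW | rewrite ge_min lexx orbT].
have dD : (d <= D)%N by rewrite /D addnAC leq_addl.
have n1E : n.-1%:R = n'%:R + L0%:R - 1 :> R.
  by rewrite -natrD -n'n -{2}(prednK n0) -natr1 addrK.
have vb' : (sumn v)%:R <= b%:R :> R by rewrite ler_nat.
have v0 : 0 <= (sumn v)%:R :> R by [].
have L00 : 0 <= L0%:R :> R by [].
have L0bE : (L0 + b + 1)%:R = L0%:R + b%:R + 1 :> R by rewrite !natrD.
have [le1|lt1] := leqP (sumn v + k) n.-1.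
- have : (d %| n.-1 - (sumn v + k))%N by rewrite -eqn_mod_dvd// cong.
  move=> /dvdnP[q qE].
  have qR : d%:R * q%:R = n.-1%:R - ((sumn v)%:R + k%:R) :> R.
    by rewrite -natrM mulnC -qE natrB// natrD.
  have hq : q%:R <= eps * Num.sqrt n'%:R.
    apply: (qbound q (d%:R * q%:R)); first by rewrite ger0_norm// mulr_ge0.
    by right; rewrite qR n1E L0bE ler_norml; lra.
  have [qm hu] := Hf n' Nfn m l q hm hl hq.
  apply: (target (m - q)%N (l + q)%N); first by clear -qE le1; rewrite /k in qE le1 *; lia.
  apply: le_trans c3f _.
  have := hu (fun i => cell p D d n' r (m - i) (l + i)).
  rewrite subn0 addn0; apply=> i; first exact: cell_ge0.
  move=> iq; have im : (m - i = (m - i.+1).+1)%N by clear -iq qm; lia.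
  by rewrite im addnS; apply: (cell_swap p n' r (m - i.+1) (l + i) d0 dD).
- have : (d %| (sumn v + k) - n.-1)%N.
    by rewrite -eqn_mod_dvd; [rewrite cong | exact: ltnW].
  move=> /dvdnP[q qE].
  have qR : d%:R * q%:R = (sumn v)%:R + k%:R - n.-1%:R :> R.
    by rewrite -natrM mulnC -qE natrB ?natrD// ltnW.
  have hq : q%:R <= eps * Num.sqrt n'%:R.
    apply: (qbound q (d%:R * q%:R)); first by rewrite ger0_norm// mulr_ge0.
    by left; rewrite qR n1E L0bE ler_norml; lra.
  have [ql hu] := Hb n' Nbn l m q hl hm hq.
  apply: (target (m + q)%N (l - q)%N).
    have : (d * q <= d * l)%N by rewrite leq_mul2l ql orbT.
    by rewrite mulnBr; clear -qE lt1; rewrite /k in qE lt1 *; lia.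
  apply: le_trans c3b _.
  have := hu (fun i => cell p D d n' r (m + i) (l - i)).
  rewrite subn0 addn0; apply=> i; first exact: cell_ge0.
  move=> iq; have il : (l - i = (l - i.+1).+1)%N by clear -iq ql; lia.
  rewrite il addnS; symmetry; exact: (cell_swap p n' r (m + i) (l - i.+1) d0 dD).
Qed.

End SizeLowerBound.

(** * From probability spaces to weights of trees *)

Section OffspringLaw.
Variables (R : realType) (mu : probability nat R).

Lemma probability_nat_fin (A : set nat) : mu A \is a fin_num.
Proof. by rewrite fin_num_measure. Qed.

Lemma offspring_pmf_ge0 i : 0 <= offspring_pmf mu i.
Proof. by rewrite fine_ge0. Qed.

Lemma integral_nat (f : nat -> R) : (forall i, 0 <= f i) ->
  (\int[mu]_x (f x)%:E = \sum_(i <oo) (offspring_pmf mu i * f i)%:E)%E.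
Proof.
move=> f0; have -> : [set: nat] = \bigcup_k [set k].
  by apply/seteqP; split=> // x _; exists x.
rewrite ge0_integral_bigcup//=; last 2 first.
- by move=> x _; rewrite lee_fin.
- by move=> i j _ _ [x [/= -> ->]].
apply: eq_eseriesr => i _; rewrite (eq_integral (cst (f i)%:E)); last first.
  by move=> x; rewrite inE /= => ->.
rewrite integral_cst//= muleC EFinM /offspring_pmf fineK//.
exact: probability_nat_fin.
Qed.

Lemma integral_nat_cvg (f : nat -> R) (l : R) : (forall i, 0 <= f i) ->
  (\int[mu]_x (f x)%:E = l%:E)%E ->
  \sum_(i < n) offspring_pmf mu i * f i @[n --> \oo] --> l.
Proof.
move=> f0; rewrite integral_nat// => fl.
have u0 i : (0 <= (offspring_pmf mu i * f i)%:E)%E.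
  by rewrite lee_fin mulr_ge0// offspring_pmf_ge0.
have cv : (\sum_(0 <= i < n) (offspring_pmf mu i * f i)%:E)%E @[n --> \oo]
    --> l%:E.
  have cv : cvgn (fun n => \sum_(0 <= i < n) (offspring_pmf mu i * f i)%:E)%E.
    by apply: is_cvg_nneseries => n _ _; exact: u0.
  by rewrite -fl; exact: cv.
apply: (cvg_trans _ (fine_cvg cv)); apply: near_eq_cvg.
by near=> n; rewrite /= sumEFin /= big_mkord.
Unshelve. all: by end_near. Qed.

Lemma offspring_critical_law : ('E_mu[@offspring R] = 1)%E ->
  ('V_mu[@offspring R] < +oo)%E ->
  critical_law (offspring_pmf mu) (fine ('V_mu[@offspring R])%E).
Proof.
move=> hE hV.
have c0 : \sum_(i < n) offspring_pmf mu i @[n --> \oo] --> (1 : R).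
  have := @integral_nat_cvg (fun=> 1) 1 (fun=> ler01).
  rewrite integral_cst//= mul1e probability_setT => /(_ erefl).
  by under eq_fun do under eq_bigr do rewrite mulr1.
have c1 : \sum_(i < n) offspring_pmf mu i * i%:R @[n --> \oo] --> (1 : R).
  by apply: (@integral_nat_cvg (fun i => i%:R)) => //; rewrite -hE unlock.
have c2 : \sum_(i < n) offspring_pmf mu i * (i%:R - 1) ^+ 2 @[n --> \oo]
    --> fine ('V_mu[@offspring R])%E.
  apply: (@integral_nat_cvg (fun i => (i%:R - 1) ^+ 2)) => [i|].
    exact: sqr_ge0.
  rewrite fineK; last by rewrite ge0_fin_numE ?variance_ge0.
  rewrite /variance unlock hE unlock.
  by apply: eq_integral => x _ /=; rewrite expr2.
split=> //; first exact: offspring_pmf_ge0.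
rewrite -[fine _](addrK 1).
rewrite (_ : (fun n => _) = (fun n =>
  \sum_(i < n) offspring_pmf mu i * (i%:R - 1) ^+ 2
  + \sum_(i < n) offspring_pmf mu i * i%:R - \sum_(i < n) offspring_pmf mu i)).
  by apply: cvgB => //; apply: cvgD.
apply/funext => n; rewrite -big_split -sumrB.
by apply: eq_bigr => i _ /=; ring.
Qed.

Lemma offspring_min_branching d : is_min_branching mu d ->
  min_branching (offspring_pmf mu) d.
Proof.
move=> [d1 d0 dmin]; split=> // i i1 id; apply/eqP; rewrite eq_le.
rewrite offspring_pmf_ge0 andbT leNgt; apply/negP => /(dmin i i1).
by rewrite leqNgt id.
Qed.

End OffspringLaw.

(** The nodes of a tree, each with its address and number of children. *)
Fixpoint nodes (t : tree) : seq (seq nat * nat) :=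
  let: Node ts := t in ([::], size ts) ::
    flatten [seq [seq (c.1 :: u.1, u.2) | u <- c.2]
            | c <- zip (iota 0 (size ts)) (map nodes ts)].

(** The first child gets the address [k], so that inductions on the list of
   children go through. *)
Definition below (k : nat) (ts : seq tree) : seq (seq nat * nat) :=
  flatten [seq [seq (c.1 :: u.1, u.2) | u <- c.2]
          | c <- zip (iota k (size ts)) (map nodes ts)].

Lemma nodesE ts : nodes (Node ts) = ([::], size ts) :: below 0 ts.
Proof. by []. Qed.

Lemma below_cons k t ts :
  below k (t :: ts) = [seq (k :: u.1, u.2) | u <- nodes t] ++ below k.+1 ts.
Proof. by []. Qed.

Lemma below_address k ts u : u \in below k ts ->
  exists j v, (k <= j)%N /\ u.1 = j :: v.
Proof.
elim: ts k => // t ts IH k; rewrite below_cons mem_cat => /orP[/mapP[v _ ->]|].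
  by exists k, v.1.
by move=> /IH[j [v [kj uE]]]; exists j, v; split=> //; exact: ltnW.
Qed.

Lemma uniq_nodes t : uniq (map fst (nodes t)).
Proof.
elim/tree_ind_mem: t => ts IH; rewrite nodesE /=; apply/andP; split.
  by apply/mapP => -[u /below_address[j [v [_ ->]]]].
elim: ts (0%N) IH => // t ts IHts k IH; rewrite below_cons map_cat cat_uniq.
apply/and3P; split.
- rewrite -map_comp (@eq_map _ _ _ (cons k \o fst))// map_comp map_inj_uniq.
    by apply: IH; exact: mem_head.
  by move=> u v [].
- apply/hasPn => _ /mapP[u /below_address[j [v [kj ->]]] ->].
  apply/mapP => -[_ /mapP[w _ ->] /= [jk _]].
  by rewrite jk ltnn in kj.
- by apply: IHts => s sts; apply: IH; rewrite in_cons sts orbT.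
Qed.

Lemma weight_nodes (R : realType) (p : nat -> R) t :
  weight p 1 t = \prod_(u <- nodes t) p u.2.
Proof.
elim/tree_ind_mem: t => ts IH; rewrite weightE mul1r nodesE big_cons /=.
congr (_ * _); elim: ts (0%N) IH => [|t ts IHts] k IH; first by rewrite !big_nil.
rewrite below_cons big_cat big_map big_cons -IH ?mem_head//=; congr (_ * _).
by apply: IHts => s sts; apply: IH; rewrite in_cons sts orbT.
Qed.

Lemma gw_tree_Node x ts : gw_tree x (Node ts) <->
  size ts = x [::] /\ forall i, (i < size ts)%N ->
    gw_tree (fun u => x (i :: u)) (nth (Node [::]) ts i).
Proof.
split=> [H|[]]; last exact: GwNode.
by inversion H.
Qed.

Lemma gw_treeP x t : gw_tree x t <-> forall u, u \in nodes t -> x u.1 = u.2.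
Proof.
elim/tree_nth_ind: t x => ts IH x; rewrite gw_tree_Node nodesE.
have bel k : (forall u, u \in below k ts -> x u.1 = u.2) <->
    forall i, (i < size ts)%N -> forall u, u \in nodes (nth (Node [::]) ts i) ->
      x ((k + i)%N :: u.1) = u.2.
  elim: ts k {IH} => [|t ts IHts] k; first by split.
  rewrite below_cons; split=> [H [|i] /= ltis u ut|H u].
  - by rewrite addn0; apply: (H (k :: u.1, u.2)); rewrite mem_cat (map_f _ ut).
  - rewrite addnS -addSn; apply: (proj1 (IHts k.+1)) => // v vb.
    by apply: H; rewrite mem_cat vb orbT.
  - rewrite mem_cat => /orP[/mapP[v vt ->] /=|].
      by have := H 0%N isT v vt; rewrite addn0.
    apply: (proj2 (IHts k.+1)) => i ltis v vt; rewrite addSn -addnS.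
    exact: (H i.+1).
split=> [[sz H] u|H].
  rewrite in_cons => /predU1P[->//|]; apply: (proj2 (bel 0%N)) => i ltis.
  exact: (proj1 (IH i ltis (fun v => x (i :: v))) (H i ltis)).
split=> [|i ltis]; first by have := H ([::], size ts) (mem_head _ _).
apply: (proj2 (IH i ltis _)) => u ut; apply: (proj1 (bel 0%N)) => // v vb.
by apply: H; rewrite in_cons vb orbT.
Qed.

Lemma gw_tree_inj x t t' : gw_tree x t -> gw_tree x t' -> t = t'.
Proof.
elim/tree_nth_ind: t x t' => ts IH x [ts'] /gw_tree_Node[sz H] /gw_tree_Node[sz' H'].
have szE : size ts = size ts' by rewrite sz sz'.
congr Node; apply: (@eq_from_nth _ (Node [::])) => // i ltis.
by apply: IH (H i ltis) (H' i _); rewrite // -szE.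
Qed.

Section GaltonWatson.
Context (R : realType) (mu : probability nat R).
Context (dOmega : measure_display) (Omega : measurableType dOmega).
Context (P : probability Omega R) (X : seq nat -> {RV P >-> nat}).
Hypothesis hX : iid_family X mu.

Definition tree_event (t : tree) : set Omega :=
  [set w | gw_tree (fun u => X u w) t].

Lemma preimage_measurable u (A : set nat) : measurable (X u @^-1` A).
Proof. by rewrite -[X in measurable X]setTI; exact: measurable_funP. Qed.

Lemma tree_eventE t : tree_event t = \big[setI/setT]_(u <- map fst (nodes t))
  X u @^-1` [set n | (u, n) \in nodes t].
Proof.
apply/seteqP; split=> w.
  move=> /gw_treeP H; rewrite -bigcap_seq => u /= /mapP[[v n] vt ->] /=.
  by rewrite (H _ vt).
rewrite -bigcap_seq => H; apply/gw_treeP => -[v n] vt /=.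
have /= := H v (map_f fst vt).
have := uniq_nodes t; elim: (nodes t) vt => // -[a b] s IH.
rewrite /= !in_cons => /predU1P[[-> ->]|vs] /andP[na us].
  move=> /predU1P[[->]//|as_]; case/negP: na.
  by apply/mapP; exists (a, X a w).
move=> /predU1P[[va _]|]; last exact: IH.
by case/negP: na; apply/mapP; exists (v, n).
Qed.

Lemma measurable_tree_event t : measurable (tree_event t).
Proof.
rewrite tree_eventE; apply: bigsetI_measurable => u _.
exact: preimage_measurable.
Qed.

(** Being the tree [t] prescribes the offspring numbers at the distinct addresses
   of [t], and nothing else. *)
Lemma probability_tree_event t :
  P (tree_event t) = (weight (offspring_pmf mu) 1 t)%:E.
Proof.
rewrite tree_eventE (hX.2 _ _ (uniq_nodes t)) big_map weight_nodes.
rewrite -prodEFin big_seq [RHS]big_seq; apply: eq_bigr => -[v n] vt /=.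
rewrite /offspring_pmf fineK ?probability_nat_fin// -(hX.1 v).
rewrite /distribution /pushforward; congr (P (_ @^-1` _)).
apply/seteqP; split=> m /=; last by move=> ->.
have := uniq_nodes t; elim: (nodes t) vt => // -[a b] s IH.
rewrite /= !in_cons => /predU1P[[-> ->]|vs] /andP[na us].
  move=> /predU1P[[->]//|as_]; case/negP: na.
  by apply/mapP; exists (a, m).
move=> /predU1P[[va _]|]; last exact: IH.
by case/negP: na; apply/mapP; exists (v, n).
Qed.

Lemma probability_trees (s : seq tree) : uniq s ->
  measurable [set w | exists2 t, t \in s & tree_event t w] /\
  P [set w | exists2 t, t \in s & tree_event t w] =
    (\sum_(t <- s) weight (offspring_pmf mu) 1 t)%:E.
Proof.
elim: s => [_|t s IH /= /andP[ts /IH[ms Ps]]].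
  have -> : [set w | exists2 t, t \in [::] & tree_event t w] = set0.
    by apply/seteqP; split=> // w [].
  by rewrite big_nil measure0.
have -> : [set w | exists2 t', t' \in t :: s & tree_event t' w] =
    tree_event t `|` [set w | exists2 t', t' \in s & tree_event t' w].
  apply/seteqP; split=> w /=.
    move=> [t']; rewrite in_cons => /predU1P[->|t's] wt'; first by left.
    by right; exists t'.
  move=> [wt|[t' t's wt']]; first by exists t => //; exact: mem_head.
  by exists t' => //; rewrite in_cons t's orbT.
have mt := measurable_tree_event t.
split; first exact: measurableU.
rewrite measureU//; last first.
  apply/seteqP; split=> // w [/= wt [t' t's wt']].
  by rewrite (gw_tree_inj wt wt') t's in ts.
rewrite big_cons EFinD; congr (_ + _)%E; last exact: Ps.
exact: probability_tree_event.
Qed.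

Lemma probability_gw_sized n (Q : set tree) :
  P (gw_event X Q `&` size_event X n) =
    (sized (offspring_pmf mu) n (fun t => `[< Q t >]))%:E.
Proof.
have us := filter_uniq (fun t => (tree_size t == n) && `[< Q t >]) (uniq_trees n n).
have [_ E] := probability_trees us.
rewrite /sized /mass -big_filter -E; congr (P _); apply/seteqP; split=> w /=.
  move=> [[t wt Qt] [t' wt' szt']]; exists t => //.
  rewrite (gw_tree_inj wt wt') in Qt *; rewrite mem_filter szt' eqxx /=.
  by rewrite (trees_of_size szt') // andbT; apply/asboolP.
move=> [t]; rewrite mem_filter => /andP[/andP[/eqP szt /asboolP Qt] _] wt.
by split; exists t.
Qed.

Lemma probability_size n :
  P (size_event X n) = (sized (offspring_pmf mu) n predT)%:E.
Proof.
have -> : size_event X n = gw_event X setT `&` size_event X n.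
  apply/seteqP; split=> w; last by case.
  by move=> [t wt szt]; split; exists t.
rewrite probability_gw_sized; congr _%:E.
by apply: eq_bigl => t; rewrite asboolT.
Qed.

End GaltonWatson.

(** * Superpolynomial decay *)

Section Asymptotics.
Variable R : realType.

Lemma ln_nat_large (t : R) : \forall n \near \oo, t <= ln (n%:R : R).
Proof.
exists (Num.bound (expR t)).+1 => // n /= Nn.
have n0 : 0 < n%:R :> R by rewrite ltr0n; exact: leq_trans Nn.
rewrite -[t]expRK ler_ln ?posrE ?expR_gt0//.
have /ltW/le_trans := archi_boundP (expR_ge0 t); apply.
by rewrite ler_nat ltnW.
Qed.

Lemma expR_ln_nat n : (0 < n)%N -> expR (ln n%:R) = n%:R :> R.
Proof. by move=> n0; rewrite lnK// posrE ltr0n. Qed.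

Lemma ln_nat_ge0 n : (0 < n)%N -> 0 <= ln n%:R :> R.
Proof. by move=> n0; rewrite ln_ge0// ler1n. Qed.

(** Sequences that are [o (n ^ (- 4))], hence negligible with respect to the
   probability of size [n]. *)
Definition fast (u : nat -> R) : Prop := forall M : R,
  \forall n \near \oo, u n <= expR (- (4 * ln n%:R + M)).

Lemma expR_ge_sqr (x : R) : 0 <= x -> x ^+ 2 / 4 <= expR x.
Proof.
move=> x0; have -> : expR x = expR (x / 2) ^+ 2.
  by rewrite -expRM_natl; congr expR; field.
have h := expR_ge1Dx (x / 2).
apply: (@le_trans _ _ ((x / 2) ^+ 2)); first by rewrite expr_div_n; lra.
by apply: lerXn2r; rewrite ?nnegrE ?expR_ge0//; lra.
Qed.

Lemma exp_dominates (c delta M : R) : 0 < c -> 0 < delta ->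
  \forall n \near \oo, 4 * ln n%:R + M <= c * expR (delta * ln n%:R).
Proof.
move=> c0 delta0; have cd : 0 < c * delta ^+ 2 by rewrite mulr_gt0 ?exprn_gt0.
near=> n.
have l0 : 0 <= ln (n%:R : R) by near: n; exact: ln_nat_large.
have lM : M <= ln n%:R by near: n; exact: ln_nat_large.
have lc : 20 / (c * delta ^+ 2) <= ln n%:R by near: n; exact: ln_nat_large.
move: (ln _) l0 lM lc => l l0 lM lc.
have h : (delta * l) ^+ 2 / 4 <= expR (delta * l).
  by apply: expR_ge_sqr; rewrite mulr_ge0// ltW.
apply: le_trans (ler_wpM2l (ltW c0) h).
rewrite ler_pdivrMr// in lc.
have h2 : 20 * l <= l * (c * delta ^+ 2) * l by apply: ler_wpM2r.
by rewrite exprMn; lra.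
Unshelve. all: by end_near. Qed.

Lemma exp_large (theta B : R) : 0 < theta ->
  \forall n \near \oo, B <= expR (theta * ln (ln n%:R / ln 2)).
Proof.
move=> t0; have l2 : 0 < ln 2 :> R by rewrite ln_gt0// ltr1n.
near=> n.
have h : ln 2 * expR (B / theta) <= ln (n%:R : R) by near: n; exact: ln_nat_large.
have h1 : expR (B / theta) <= ln (n%:R : R) / ln 2 by rewrite ler_pdivlMr// mulrC.
have h2 : B / theta <= ln (ln (n%:R : R) / ln 2).
  by rewrite -[leLHS]expRK ler_ln// posrE ?expR_gt0//; apply: lt_le_trans h1; exact: expR_gt0.
rewrite ler_pdivrMr// in h2.
apply: le_trans (expR_ge1Dx _); lra.
Unshelve. all: by end_near. Qed.

Lemma le_expRN (x : R) k : 0 <= x <= 1 -> (1 - x) ^+ k <= expR (- (k%:R * x)).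
Proof.
move=> x01; rewrite -mulrN expRM_natl; apply: lerXn2r; rewrite ?nnegrE ?expR_ge0//.
  by lra.
exact: expR_ge1Dx.
Qed.

Lemma inv_le_expRN (x : R) k : 0 <= x <= 1 ->
  (1 + x) ^- k <= expR (- (k%:R * (x / 2))).
Proof.
move=> x01; have x1 : 0 < 1 + x by lra.
rewrite -mulrN expRM_natl -exprVn; apply: lerXn2r; rewrite ?nnegrE ?expR_ge0//.
  by rewrite invr_ge0; lra.
apply: le_trans (expR_ge1Dx _).
rewrite -[leLHS]mul1r ler_pdivrMr//.
have : 0 <= x * (1 - x) by rewrite mulr_ge0; lra.
by move=> h; lra.
Qed.

Variables (p : nat -> R) (s2 : R) (d : nat).
Hypothesis hp : critical_law p s2.
Hypothesis hd : min_branching p d.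
Let p_ge0 := law_ge0 hp.

(** When the unconditioned tail at level [r n] exceeds [n ^ (- 1 / 2)] by a
   power of [n], a tree with a smaller number is either too short for its
   size or too high for its number, whatever height is used to separate the
   two; [n ^ (1 / 2 - delta)] makes both events superpolynomially rare. *)
Lemma fast_HS_le (c delta : R) (r : nat -> nat) (s : nat -> R) :
  0 < c -> 0 < delta -> delta <= 1 / 4 -> (forall n, 0 <= s n <= 1) ->
  (forall n D h, mass p 1 D h (HS_le (r n)) <= 1 - s n) ->
  (\forall n \near \oo, c * expR (- ((1 / 2 - 2 * delta) * ln n%:R)) <= s n) ->
  fast (fun n => sized p n (HS_le (r n))).
Proof.
move=> c0 delta0 delta1 s01 Hs sc M.
have s20 := variance_gt0 hp hd; have pd0 := branch_gt0 hd.
have pd1 := law_le1 hp d.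
pose K := 1 + 2 * s2.
have K1 : 1 <= K by rewrite /K; lra.
have Ks : 2 * s2 <= K by rewrite /K; lra.
pose c' := Num.min (c * p d) (32 * K)^-1.
have c'0 : 0 < c' by rewrite lt_min mulr_gt0//= invr_gt0; lra.
have dom := exp_dominates (M + 1) c'0 delta0.
near=> n.
have n0 : (0 < n)%N by near: n; exists 1%N.
have l0 := ln_nat_ge0 n0; have nl := expR_ln_nat n0.
have domn : 4 * ln n%:R + (M + 1) <= c' * expR (delta * ln n%:R) by near: n.
have scn : c * expR (- ((1 / 2 - 2 * delta) * ln n%:R)) <= s n by near: n.
move: (ln n%:R) l0 nl domn scn => l l0 nl domn scn.
set X := expR (delta * l) in domn.
pose E := expR ((1 / 2 - delta) * l).
have X1 : 1 <= X by rewrite -expR0 ler_expR mulr_ge0// ltW.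
have E1 : 1 <= E by rewrite -expR0 ler_expR mulr_ge0//; lra.
pose k := (Num.truncn E).+1.
have Ek : E <= k%:R by apply/ltW; exact: truncnS_gt.
have kE : k%:R <= 2 * E.
  have E0 : 0 <= E by lra.
  by have /andP[h _] := truncn_itv E0; rewrite /k -[_.+1%:R]natr1; lra.
apply: le_trans (sized_HS_le hp hd n K1 Ks (ltn0Sn _) (s01 n) (Hs n)) _.
rewrite -/k; have /andP[sn0 sn1] := s01 n.
have sp01 : 0 <= s n * p d <= 1 by rewrite mulr_ge0 ?mulr_ile1// ltW.
have T1 : (1 - s n * p d) ^+ k <= expR (- (c' * X)).
  apply: le_trans (le_expRN k sp01) _; rewrite ler_expR lerN2.
  apply: (@le_trans _ _ (c * p d * X)).
    by apply: ler_wpM2r; [lra | rewrite ge_min lexx].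
  rewrite mulrA mulrAC; apply: ler_wpM2r; first exact: ltW.
  have -> : X = E * expR (- ((1 / 2 - 2 * delta) * l)).
    by rewrite /E -expRD; congr expR; lra.
  rewrite mulrCA; apply: ler_pM => //; first lra.
  by rewrite mulr_ge0 ?expR_ge0// ltW.
have k0 : 0 < k%:R :> R by rewrite ltr0n.
pose eta : R := (4 * K * k%:R ^+ 2)^-1.
have kk0 : 0 < 4 * K * k%:R ^+ 2 by rewrite !mulr_gt0 ?exprn_gt0//; lra.
have k1 : 1 <= k%:R :> R by rewrite ler1n.
have eta01 : 0 <= eta <= 1.
  rewrite invr_ge0 ltW//= invf_le1//.
  have : 1 <= k%:R ^+ 2 :> R by rewrite exprn_ege1.
  by move=> h; rewrite -[1]mulr1; apply: ler_pM => //; lra.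
have T2 : (1 + eta) ^- n <= expR (- (c' * X)).
  apply: le_trans (inv_le_expRN n eta01) _; rewrite ler_expR lerN2.
  apply: (@le_trans _ _ ((32 * K)^-1 * X)).
    by apply: ler_wpM2r; [lra | rewrite ge_min lexx orbT].
  have kE2 : k%:R ^+ 2 <= (2 * E) ^+ 2.
    by apply: lerXn2r; rewrite ?nnegrE; lra.
  have XX : X <= X ^+ 2 by rewrite expr2 ler_peMl; lra.
  have nE : n%:R = E ^+ 2 * X ^+ 2.
    by rewrite -nl /E /X -!expRM_natl -expRD; congr expR; lra.
  have -> : n%:R * (eta / 2) = n%:R / (8 * K * k%:R ^+ 2).
    by rewrite /eta; field; rewrite !gt_eqF//; lra.
  rewrite ler_pdivlMr; last by rewrite !mulr_gt0 ?exprn_gt0//; lra.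
  have -> : (32 * K)^-1 * X * (8 * K * k%:R ^+ 2) = X * (k%:R ^+ 2 / 4).
    by field; rewrite gt_eqF//; lra.
  have kE4 : k%:R ^+ 2 / 4 <= E ^+ 2 by move: kE2; rewrite exprMn; lra.
  have kk4 : 0 <= k%:R ^+ 2 / 4 :> R by rewrite divr_ge0 ?sqr_ge0.
  by rewrite nE [leRHS]mulrC; apply: ler_pM => //; lra.
apply: le_trans (lerD T1 T2) _.
have e2 : 2 <= expR 1 :> R by have := expR_ge1Dx (1 : R); lra.
have e0 := expR_ge0 (- (c' * X)).
apply: (@le_trans _ _ (expR 1 * expR (- (c' * X)))).
  by have := ler_wpM2r e0 e2; lra.
by rewrite -expRD ler_expR; lra.
Unshelve. all: by end_near. Qed.

Lemma fast_HS_le_binary (eps : R) (gamma := 1 + Num.sqrt (s2 / (2 * p 2%N))) :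
  d = 2%N -> 0 < eps ->
  fast (fun n => sized p n
    (HS_le (Num.truncn (ln n%:R * (1 / (2 * ln gamma) - eps))))).
Proof.
move=> d2 eps0; have g1 : 1 < gamma by exact: (gamma_gt1 hp hd d2).
have lg0 : 0 < ln gamma by rewrite ln_gt0.
have p20 : 0 < p 2%N by rewrite -d2 (branch_gt0 hd).
pose delta := Num.min (ln gamma * eps / 2) (1 / 4).
have delta0 : 0 < delta by rewrite lt_min divr_gt0 ?mulr_gt0//=; lra.
have delta1 : delta <= 1 / 4 by rewrite ge_min lexx orbT.
have delta2 : 2 * delta <= ln gamma * eps.
  have : delta <= ln gamma * eps / 2 by rewrite ge_min lexx.
  by move=> h; lra.
apply: (@fast_HS_le (p 2%N) delta _
  (fun n => p 2%N * gamma ^- (Num.truncn (ln n%:R * (1 / (2 * ln gamma) - eps)))))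
  => //.
- move=> n; move: (Num.truncn _) => r.
  have gr : 1 <= gamma ^+ r by apply: exprn_ege1; lra.
  have v0 : 0 <= gamma ^- r by rewrite invr_ge0; lra.
  have v1 : gamma ^- r <= 1 by rewrite invf_le1; lra.
  have p21 : p 2%N <= 1 by exact: (law_le1 hp).
  by rewrite mulr_ge0 ?(ltW p20)//= mulr_ile1// ltW.
- by move=> n D h; exact: (mass_HS_le_binary hp hd d2).
near=> n; have n0 : (0 < n)%N by near: n; exists 1%N.
have l0 := ln_nat_ge0 n0; move: (ln n%:R) l0 => l l0.
apply: ler_wpM2l; first exact: ltW.
have -> r : gamma ^- r = expR (- (r%:R * ln gamma)).
  by rewrite expRN expRM_natl lnK// posrE; lra.
rewrite ler_expR lerN2; set x := l * _.
have [x0|x0] := leP 0 x; last first.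
  rewrite (_ : Num.truncn x = 0%N) ?mul0r ?mulr_ge0//; first by lra.
  by apply/eqP; rewrite -leqn0 truncn_le_nat; lra.
have /andP[rx _] := truncn_itv x0.
apply: le_trans (ler_wpM2r (ltW lg0) rx) _.
have -> : x * ln gamma = l * (1 / 2 - ln gamma * eps).
  by rewrite /x; field; rewrite gt_eqF.
by rewrite [leRHS]mulrC; apply: ler_wpM2l => //; lra.
Unshelve. all: by end_near. Qed.

(** The level of [n] is reached in two stages: up to [r0 n] the unconditioned tail
   decreases to [n ^ (- 1 / 2 - theta)], at a rate [g'] close enough to
   [ln gamma]; then [j] more levels square the ratio of the mass to
   [n ^ (- 1 / 2)] as many times. *)
Lemma fast_HS_gt_binary (eps : R) (gamma := 1 + Num.sqrt (s2 / (2 * p 2%N))) :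
  d = 2%N -> 0 < eps -> exists r : nat -> nat,
  (\forall n \near \oo, (r n)%:R <= ln n%:R * (1 / (2 * ln gamma) + eps)) /\
  fast (fun n => sized p n (HS_gt (r n))).
Proof.
move=> d2 eps0; have gam1 : 1 < gamma by exact: (gamma_gt1 hp hd d2).
have s20 := variance_gt0 hp hd.
have p20 : 0 < p 2%N by rewrite -d2 (branch_gt0 hd).
pose g := ln gamma; have g0 : 0 < g by rewrite ln_gt0.
have ge0 : 0 < g * eps by rewrite mulr_gt0.
pose g' := g / (1 + g * eps / 2).
have g'0 : 0 < g' by rewrite divr_gt0//; lra.
have g'g : g' < g by rewrite ltr_pdivrMr; [rewrite ltr_pMr; lra | lra].
pose theta := (g * eps / 4) / (1 + g * eps / 2).
have theta0 : 0 < theta by apply: divr_gt0; lra.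
have exponent : g' * (1 / (2 * g) + eps / 2) = 1 / 2 + theta.
  by rewrite /g' /theta; field; rewrite !gt_eqF//; lra.
have eg1 : 1 < expR g' by rewrite -expR0 ltr_expR.
have eg2 : expR g' < gamma.
  by rewrite -[ltRHS]lnK ?ltr_expR// posrE; lra.
have [C C0 HC] := mass_HS_gt_binary hp hd d2 eg1 eg2.
pose c0 := (2 + s2)^-1.
have c00 : 0 < c0 by rewrite invr_gt0; lra.
have c01 : c0 <= 1 / 2 by rewrite div1r lef_pV2 ?posrE; lra.
have c02 : s2 / 2 * c0 ^+ 2 <= 1 / 4.
  have e : (2 + s2) * c0 = 1 by rewrite divff// gt_eqF//; lra.
  have : s2 * c0 <= 1 by lra.
  move=> h; have h2 : (s2 * c0) * c0 <= 1 * c0 by apply: ler_wpM2r => //; lra.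
  by lra.
pose C2 := C * expR g' / (c0 * p d).
have pd0 := branch_gt0 hd; have pd1 := law_le1 hp d.
have C20 : 0 < C2 by apply: divr_gt0; apply: mulr_gt0 => //; exact: expR_gt0.
have [j J5] : exists j, 5 <= theta * (2 ^ j)%:R.
  have b0 : 0 <= 5 / theta by apply: divr_ge0; lra.
  have := archi_boundP b0; move: (Num.bound _) => j hj; exists j.
  rewrite mulrC -ler_pdivrMr//; apply: (@le_trans _ _ j%:R); first exact: ltW.
  by rewrite ler_nat ltnW// ltn_expl.
have [J JE] : exists J, J = (2 ^ j)%N by exists (2 ^ j)%N.
rewrite -JE in J5.
pose r0 n := Num.truncn (ln (n%:R : R) * (1 / (2 * g) + eps / 2)).
exists (fun n => (r0 n + j)%N); split.
  near=> n; have n0 : (0 < n)%N by near: n; exists 1%N.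
  have l0 := ln_nat_ge0 n0.
  have lj : j%:R / (eps / 2) <= ln n%:R by near: n; exact: ln_nat_large.
  have x0 : 0 <= ln n%:R * (1 / (2 * g) + eps / 2).
    have q0 : 0 <= 1 / (2 * g) by apply: divr_ge0; lra.
    by apply: mulr_ge0 => //; lra.
  have /andP[h _] := truncn_itv x0.
  rewrite ler_pdivrMr in lj; last by lra.
  by move: h; rewrite natrD -/(r0 n); move: (r0 n) => q h; lra.
move=> M; near=> n; have n0 : (0 < n)%N by near: n; exists 1%N.
have l0 := ln_nat_ge0 n0; have nl := expR_ln_nat n0.
have big : ln (2 * C2 ^+ J) + M <= ln n%:R by near: n; exact: ln_nat_large.
pose y : R := c0 * expR (- (ln n%:R / 2)).
have eneg : expR (- (ln n%:R / 2)) <= 1 :> R by rewrite -[leRHS]expR0 ler_expR; lra.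
have epos : 0 < expR (- (ln n%:R / 2)) :> R by exact: expR_gt0.
have y0 : 0 < y by rewrite mulr_gt0.
have yc0 : y <= c0 by rewrite /y ler_piMr// ltW.
have y2 : y <= 1 / 2 by lra.
have n0' : 0 < n%:R :> R by rewrite ltr0n.
have yn : s2 / 2 * y ^+ 2 <= (4 * n%:R)^-1.
  have -> : s2 / 2 * y ^+ 2 = s2 / 2 * c0 ^+ 2 * expR (- (ln n%:R / 2)) ^+ 2.
    by rewrite /y exprMn mulrA.
  have -> : expR (- (ln n%:R / 2)) ^+ 2 = n%:R^-1 :> R.
    by rewrite -expRM_natl -[in RHS]nl -expRN; congr expR; field.
  by rewrite invfM; apply: ler_wpM2r; [rewrite invr_ge0 ltW | lra].
pose x := C2 * expR (- (theta * ln n%:R)).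
have x0 : 0 <= x by rewrite mulr_ge0 ?expR_ge0// ltW.
have Hx D h : mass p 1 D h (HS_gt (r0 n)) <= y * p d * x.
  apply: le_trans (HC (r0 n) D h) _.
  have -> : y * p d * x = C * expR (g' - (1 / 2 + theta) * ln n%:R).
    have -> : g' - (1 / 2 + theta) * ln n%:R =
      - (ln n%:R / 2) + g' + - (theta * ln n%:R) by ring.
    rewrite !expRD /y /x /C2; field.
    by rewrite !gt_eqF.
  apply: ler_wpM2l; first exact: ltW.
  rewrite -expRM_natl -expRN ler_expR -exponent.
  set t := ln n%:R * (1 / (2 * g) + eps / 2).
  have rt : t <= (r0 n)%:R + 1 by rewrite natr1; apply/ltW; exact: truncnS_gt.
  have -> : g' * (1 / (2 * g) + eps / 2) * ln n%:R = g' * t by rewrite /t; ring.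
  by have := ler_wpM2l (ltW g'0) rt; lra.
apply: le_trans (sized_HS_gt hp hd n0 y0 y2 yn j x0 Hx) _; rewrite -JE.
have yp : y * p d <= 1 by rewrite mulr_ile1//; lra.
have xJ : x ^+ J <= C2 ^+ J * expR (- (5 * ln n%:R)).
  rewrite exprMn; apply: ler_wpM2l; first by rewrite exprn_ge0// ltW.
  rewrite -expRM_natl ler_expR mulrN lerN2 mulrA [J%:R * _]mulrC.
  exact: ler_wpM2r.
have xJ0 : 0 <= x ^+ J by rewrite exprn_ge0.
have C2J : 0 < 2 * C2 ^+ J by rewrite mulr_gt0 ?exprn_gt0.
apply: (@le_trans _ _ (2 * C2 ^+ J * expR (- (5 * ln n%:R)))).
  rewrite -[leRHS]mulrA; apply: ler_wpM2l => //; apply: le_trans xJ.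
  by rewrite ler_piMl.
rewrite -[X in X * _]lnK ?posrE// -expRD ler_expR; lra.
Unshelve. all: by end_near. Qed.

End Asymptotics.

(** * Levels for a least branching number above two *)

Section NonBinaryAsymptotics.
Variables (R : realType) (p : nat -> R) (s2 : R) (d : nat).
Hypothesis hp : critical_law p s2.
Hypothesis hd : min_branching p d.
Hypothesis d3 : (2 < d)%N.
Let p_ge0 := law_ge0 hp.
Let lam : R := d%:R / 2.
Let LL n : R := ln (ln n%:R / ln 2).

Lemma ln2_gt0 : 0 < ln 2 :> R. Proof. by rewrite ln_gt0// ltr1n. Qed.

Lemma loglog_large (t : R) : \forall n \near \oo, t <= LL n.
Proof.
have h := exp_large (expR t) (@ltr01 R); near=> n.
by rewrite -ler_expR -[LL n]mul1r; near: n; exact: h.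
Unshelve. all: by end_near. Qed.

Lemma expR_loglog n : 0 < ln (n%:R : R) -> expR (LL n) = ln n%:R / ln 2.
Proof. by move=> l0; rewrite /LL lnK// posrE divr_gt0// ln2_gt0. Qed.

Lemma expR_ln_lam r : lam ^+ r = expR (r%:R * ln lam).
Proof.
have l1 : 1 < lam by exact: lam_gt1.
by rewrite expRM_natl lnK// posrE; lra.
Qed.

Lemma fast_HS_le_nonbinary (eps : R) : 0 < eps ->
  fast (fun n => sized p n (HS_le (Num.truncn (LL n * (1 / ln lam - eps))))).
Proof.
move=> eps0; have l1 : 1 < lam by exact: lam_gt1.
have g0 : 0 < ln lam by rewrite ln_gt0.
have l20 := ln2_gt0.
have [C C0 HC] := mass_HS_le_nonbinary hp hd d3.
pose r n := Num.truncn (LL n * (1 / ln lam - eps)).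
apply: (@fast_HS_le _ _ _ _ hp hd 1 (1 / 8) r
  (fun n => expR (- (C * lam ^+ r n)))) => //; try lra.
  move=> n; rewrite expR_ge0/= -[leRHS]expR0 ler_expR oppr_le0 mulr_ge0// exprn_ge0//.
  by lra.
have ge0 : 0 < ln lam * eps by rewrite mulr_gt0.
have big := exp_large (4 * C / ln 2) ge0.
near=> n; have lC : 4 * C + 1 <= ln (n%:R : R) by near: n; exact: ln_nat_large.
have bign : 4 * C / ln 2 <= expR (ln lam * eps * LL n) by near: n.
rewrite mul1r ler_expR lerN2 (_ : 1 / 2 - 2 * (1 / 8) = 1 / 4); last by lra.
rewrite /r; set x := LL n * _.
have [x0|x0] := leP 0 x; last first.
  rewrite (_ : Num.truncn x = 0%N) ?expr0; first by lra.
  by apply/eqP; rewrite -leqn0 truncn_le_nat; lra.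
have /andP[rx _] := truncn_itv x0; move: (Num.truncn x) rx => q rx.
have ln0 : 0 < ln (n%:R : R) by lra.
have h1 : lam ^+ q * expR (ln lam * eps * LL n) <= ln n%:R / ln 2.
  rewrite -expR_loglog// expR_ln_lam -expRD ler_expR.
  apply: le_trans (lerD (ler_wpM2r (ltW g0) rx) (lexx _)) _.
  by rewrite le_eqVlt; apply/orP; left; apply/eqP; rewrite /x; field; rewrite gt_eqF.
have lr0 : 0 <= lam ^+ q by rewrite exprn_ge0//; lra.
have h2 := ler_wpM2l lr0 bign.
have h3 : lam ^+ q * (4 * C / ln 2) <= ln n%:R / ln 2.
  exact: le_trans h2 h1.
rewrite ler_pdivlMr// in h3.
have E : lam ^+ q * (4 * C / ln 2) * ln 2 = 4 * (C * lam ^+ q).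
  by field; rewrite gt_eqF.
by rewrite E in h3; lra.
Unshelve. all: by end_near. Qed.

Lemma fast_HS_gt_nonbinary (eps : R) : 0 < eps -> exists r : nat -> nat,
  (\forall n \near \oo, (r n)%:R <= LL n * (1 / ln lam + eps)) /\
  fast (fun n => sized p n (HS_gt (r n))).
Proof.
move=> eps0; have l1 : 1 < lam by exact: lam_gt1.
have g0 : 0 < ln lam by rewrite ln_gt0.
have l20 := ln2_gt0.
have [r0 Hr0] := mass_HS_gt_nonbinary hp hd d3.
pose r n := Num.truncn (LL n * (1 / ln lam + eps / 2)).
have ig0 : 0 <= 1 / ln lam by rewrite divr_ge0// ltW.
exists (fun n => (r0 + r n)%N); split.
  near=> n; have L0 : 0 <= LL n by near: n; exact: loglog_large.
  have Lr : r0%:R / (eps / 2) <= LL n by near: n; exact: loglog_large.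
  have x0 : 0 <= LL n * (1 / ln lam + eps / 2) by rewrite mulr_ge0//; lra.
  have /andP[rx _] := truncn_itv x0.
  rewrite ler_pdivrMr in Lr; last by lra.
  by move: rx; rewrite natrD -/(r n); move: (r n) => q rx; lra.
move=> M; have ge0 : 0 < ln lam * eps / 2 by rewrite divr_gt0 ?mulr_gt0.
have big := exp_large (5 * ln 2 * expR (ln lam)) ge0.
near=> n; have lM : M <= ln (n%:R : R) by near: n; exact: ln_nat_large.
have ln1 : 1 <= ln (n%:R : R) by near: n; exact: ln_nat_large.
have bign : 5 * ln 2 * expR (ln lam) <= expR (ln lam * eps / 2 * LL n) by near: n.
apply: (@le_trans _ _ (mass p 1 n n (HS_gt (r0 + r n)))).
  by apply: mass_sub => // t /andP[].
apply: le_trans (Hr0 _ _ _) _; rewrite ler_expR lerN2 expR_ln_lam.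
have rx : LL n * (1 / ln lam + eps / 2) - 1 <= (r n)%:R.
  by rewrite lerBlDr natr1; apply/ltW; exact: truncnS_gt.
move: (r n) rx => q rx.
have ln0 : 0 < ln (n%:R : R) by lra.
have h : ln n%:R / ln 2 * (5 * ln 2 * expR (ln lam)) / expR (ln lam)
    <= expR (q%:R * ln lam).
  rewrite ler_pdivrMr ?expR_gt0// -expRD.
  apply: (@le_trans _ _ (ln n%:R / ln 2 * expR (ln lam * eps / 2 * LL n))).
    by apply: ler_wpM2l => //; rewrite divr_ge0// ltW.
  rewrite -expR_loglog// -expRD ler_expR.
  have := ler_wpM2r (ltW g0) rx.
  have -> : (LL n * (1 / ln lam + eps / 2) - 1) * ln lam =
    LL n + ln lam * eps / 2 * LL n - ln lam by field; rewrite gt_eqF.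
  by lra.
have E : ln n%:R / ln 2 * (5 * ln 2 * expR (ln lam)) / expR (ln lam) = 5 * ln n%:R.
  by field; rewrite !gt_eqF ?expR_gt0.
by rewrite E in h; lra.
Unshelve. all: by end_near. Qed.

End NonBinaryAsymptotics.

(** * Convergence in probability *)

Section Convergence.
Context (R : realType) (mu : probability nat R).
Context (dOmega : measure_display) (Omega : measurableType dOmega).
Context (P : probability Omega R) (X : seq nat -> {RV P >-> nat}).
Hypothesis hX : iid_family X mu.
Context (s2 : R) (d : nat).
Let p := offspring_pmf mu.
Hypothesis hp : critical_law p s2.
Hypothesis hd : min_branching p d.
Let p_ge0 := law_ge0 hp.

Lemma cvg_in_prob_fast (f : nat -> tree -> R) (l : R) :
  (forall eps, 0 < eps -> exists S1 S2 : nat -> pred tree,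
    [/\ \forall n \near \oo, forall t, eps < `|f n t - l| -> S1 n t || S2 n t,
        fast (fun n => sized p n (S1 n)) & fast (fun n => sized p n (S2 n))]) ->
  cvg_in_prob_given_size X f l.
Proof.
move=> H eps eps0; have [S1 [S2 [HS F1 F2]]] := H eps eps0.
have [c c0 [N HN]] := sized_ge hp hd.
apply/cvgr0Pnorm_le => e e0; rewrite near_withinE.
pose M := - ln (e * c / 2).
have F1M := F1 M; have F2M := F2 M.
near=> n => /= an0.
have n0 : (0 < n)%N by near: n; exists 1%N.
have Nn : (N <= n)%N by near: n; exists N.
have nl := expR_ln_nat R n0.
have HSn : forall t, eps < `|f n t - l| -> S1 n t || S2 n t by near: n.
have f1 : sized p n (S1 n) <= expR (- (4 * ln n%:R + M)) by near: n.
have f2 : sized p n (S2 n) <= expR (- (4 * ln n%:R + M)) by near: n.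
rewrite (probability_size hX) lte_fin in an0.
rewrite /cond_prob (probability_gw_sized hX) (probability_size hX) /=.
set B := sized _ n (fun t => _); set a := sized _ n predT in an0 *.
have B0 : 0 <= B by exact: sized_ge0.
rewrite ger0_norm ?divr_ge0 ?(ltW an0)// ler_pdivrMr//.
have BS : B <= sized p n (S1 n) + sized p n (S2 n).
  rewrite /B /sized /mass big_mkcond [X in _ <= X + _]big_mkcond.
  rewrite [X in _ <= _ + X]big_mkcond -big_split; apply: ler_sum => t _ /=.
  have w0 : 0 <= weight p 1 t by exact: weight_ge0.
  case: (tree_size t == n) => /=; last by rewrite addr0.
  case: asboolP => [/HSn|_]; last by apply: addr_ge0; case: ifP.
  by case: (S1 n t); case: (S2 n t) => //= _; lra.
have ca : c / n%:R ^+ 4 <= a by exact: HN.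
have E : expR (- (4 * ln n%:R + M)) = e * (c / n%:R ^+ 4) / 2.
  rewrite /M opprD opprK expRD lnK; last by rewrite posrE divr_gt0 ?mulr_gt0.
  rewrite expRN (expRM_natl 4) nl; field.
  by rewrite gt_eqF// ltr0n.
have := ler_wpM2l (ltW e0) ca.
by rewrite E in f1 f2; lra.
Unshelve. all: by end_near. Qed.

End Convergence.

Lemma deviation_cases (R : realFieldType) (s l eps r : R) : 0 < s ->
  eps < `|r / s - l| -> s * (l + eps) < r \/ r < s * (l - eps).
Proof.
move=> s0; rewrite ltr_normr => /orP[h|h]; [left|right].
  by rewrite mulrC -ltr_pdivlMr//; lra.
by rewrite mulrC -ltr_pdivrMr//; lra.
Qed.

Lemma HS_le_truncn (R : realType) (x : R) t :
  (rigid_HS t)%:R < x -> HS_le (Num.truncn x) t.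
Proof.
move=> tx; have x0 : 0 <= x by apply: le_trans (ltW tx).
by rewrite /HS_le truncn_ge_nat// ltW.
Qed.

Lemma HS_gt_lt (R : realType) (x : R) r t :
  r%:R <= x -> x < (rigid_HS t)%:R -> HS_gt r t.
Proof.
by move=> rx xt; rewrite /HS_gt /HS_le -ltnNge -(ltr_nat R); exact: le_lt_trans rx xt.
Qed.

Theorem theorem10 (R : realType) (mu : probability nat R)
  (hmean : ('E_mu[@offspring R] = 1)%E)
  (hvar : (0 < 'V_mu[@offspring R] < +oo)%E)
  (dOmega : measure_display) (Omega : measurableType dOmega)
  (P : probability Omega R) (X : seq nat -> {RV P >-> nat})
  (hX : iid_family X mu)
  (d : nat) (hd : is_min_branching mu d) :
  ((2 < d)%N ->
     cvg_in_prob_given_size X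
       (fun n t => (rigid_HS t)%:R / log2 (log2 n%:R))
       (1 / log2 (d%:R / 2))) /\
  (d = 2%N ->
     let sigma2 := fine ('V_mu[@offspring R])%E in
     let gamma := 1 + Num.sqrt (sigma2 / (2 * offspring_pmf mu 2%N)) in
     cvg_in_prob_given_size X
       (fun n t => (rigid_HS t)%:R / log2 n%:R)
       (1 / (2 * log2 gamma))).
Proof.
have /andP[_ hvar'] := hvar.
have hp := offspring_critical_law hmean hvar'.
have hb := offspring_min_branching hd.
have l20 := ln2_gt0 R.
split=> [d3|d2 sigma2 gamma]; apply: (cvg_in_prob_fast hX hp hb) => eps eps0;
    have eps0' : 0 < eps / ln 2 by rewrite divr_gt0.
- have l1 : 1 < d%:R / 2 :> R by exact: lam_gt1.
  have g0 : 0 < ln (d%:R / 2) :> R by rewrite ln_gt0.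
  have [r [Hr Fr]] := fast_HS_gt_nonbinary hp hb d3 eps0'.
  have Fl := fast_HS_le_nonbinary hp hb d3 eps0'.
  eexists; eexists; split; [|exact: Fr|exact: Fl].
  near=> n => t; rewrite /log2; set LL := ln (ln _ / ln 2).
  have L0 : 1 <= LL by rewrite /LL; near: n; exact: loglog_large.
  have rn : (r n)%:R <= LL * (1 / ln (d%:R / 2) + eps / ln 2).
    by rewrite /LL; near: n.
  have s0 : 0 < LL / ln 2 by rewrite divr_gt0//; lra.
  move=> /(deviation_cases s0)[h|h]; apply/orP; [left|right].
    apply: (HS_gt_lt rn); apply: le_lt_trans h.
    by rewrite le_eqVlt; apply/orP; left; apply/eqP; field; rewrite !gt_eqF.
  apply: HS_le_truncn; apply: (lt_le_trans h).
  by rewrite le_eqVlt; apply/orP; left; apply/eqP; field; rewrite !gt_eqF.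
- have g1 : 1 < gamma by exact: (gamma_gt1 hp hb d2).
  have g0 : 0 < ln gamma by rewrite ln_gt0.
  have [r [Hr Fr]] := fast_HS_gt_binary hp hb d2 eps0'.
  have Fl := fast_HS_le_binary hp hb d2 eps0'.
  eexists; eexists; split; [|exact: Fr|exact: Fl].
  near=> n => t; rewrite /log2.
  have L0 : 1 <= ln (n%:R : R) by near: n; exact: ln_nat_large.
  have rn : (r n)%:R <= ln n%:R * (1 / (2 * ln gamma) + eps / ln 2) by near: n.
  have s0 : 0 < ln n%:R / ln 2 :> R by rewrite divr_gt0//; lra.
  move=> /(deviation_cases s0)[h|h]; apply/orP; [left|right].
    apply: (HS_gt_lt rn); apply: le_lt_trans h.
    by rewrite le_eqVlt; apply/orP; left; apply/eqP; field; rewrite !gt_eqF.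
  apply: HS_le_truncn; apply: (lt_le_trans h).
  by rewrite le_eqVlt; apply/orP; left; apply/eqP; field; rewrite !gt_eqF.
Unshelve. all: by end_near. Qed.
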